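(* Consider a ledger QROM execution with random oracle $H:\mathcal X\to\mathcal Y$, $|\mathcal Y|=2^\lambda$, and a closed finalized cut $\Theta$ with target set $C$, $|C|\le K$, and bad norm at the cut $\beta_{\mathsf{cut}}$. Let $W$ be the event of the first winning acceptance. Assume $W\subseteq\{\Theta<\infty\}$ and that, on every branch in $W$, the cut occurs before every checked oracle evaluation used to witness that acceptance; branches on which the cut does not occur are assigned $W=0$. Suppose that on $W$ the retained validation history contains one of at most $\ell$ checked points $x_j$ for which $$\mathsf{Fresh}(z,\omega,x_j)=1,\qquad H(x_j)\in C .$$ For every such check, the verifier evaluates $y_j=H(x_j)$ after the cut, charges that evaluation to the post-cut budget, and copies $(x_j,y_j)$ into a classical check register. Let at most $Q$ oracle evaluations occur after the cut, counting every direct, mediated, honest, and final check evaluation capable of affecting the relation. Then there is a universal constant $c_{\mathsf{co}}$ such that $$\sqrt{\Pr[W]}\le\beta_{\mathsf{cut}}+Q\sqrt{\frac{c_{\mathsf{co}}K}{2^\lambda}}+\sqrt{\frac{2\ell}{2^\lambda}} .$$ Consequently, $$\Pr[W]\le 3\beta_{\mathsf{cut}}^2+\frac{3c_{\mathsf{co}}KQ^2}{2^\lambda}+\frac{6\ell}{2^\lambda}.$$ The standard transition capacity formulation for compressed oracles permits $c_{\mathsf{co}}=10$.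
   Context: LEDGER QROM EXECUTION. $H:\mathcal X\to\mathcal Y$ is uniformly random with $|\mathcal Y|=2^\lambda$. An execution consists of a classical ledger environment $\mathcal E$ (which runs a fixed public classical polynomial-time ledger transition machine and the honest algorithms), a quantum adversary $\mathcal A$, and the common oracle $H$. Between classical calls $\mathcal A$ may apply arbitrary quantum circuits and query $|x,z,w\rangle\mapsto|x,z\oplus H(x),w\rangle$. To call a ledger interface it designates a message register, which $\mathcal E$ measures in the computational basis, processes as a classical command, and answers classically; only the interface register is measured, and all other adversarial workspace persists across slots, blocks, finality events and calls. $\mathcal E$ may evaluate the same $H$ on classical inputs while validating events or producing honest messages; it updates the pending pool, state, clock, transcript and finalized prefix, and exposes every public emission and receipt classically. Evaluations are: direct (adversary's quantum queries), mediated (verifier evaluations on adversarially supplied inputs whose result affects a visible response), honest (on private inputs), and retained candidate/output checks. CLOSED FINALIZED CUT. Let $\mathcal F_t$ be the classical filtration generated by the public transcript, responses, clock, randomness and finality certificates through slot $t$. A finalized cut is an $\mathcal F_t$ stopping time $\Theta$; at the cut the environment computes $C_\Theta=g(\mathcal T^{\mathsf{fin}}_\Theta)\subseteq\mathcal Y$ from the finalized transcript prefix and copies it into a read-only classical register $C$. The cut is closed for the acceptance relation if, on every continuation of a cut branch, no value outside $C_\Theta$ can become eligible for a later winning check; equivalently, whenever a later acceptance is witnessed by a checked point $x$, $H(x)\in C_\Theta$. The adversary may influence $\Theta$ and $C_\Theta$ (through scheduling, oracle queries and events before the cut), but every branch satisfies the public bound $|C_\Theta|\le K$. $C_\Theta$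 need not be independent of $H$. FRESHNESS. $z$ is the classical cut transcript; $\omega$ is a hidden value sampled and stored in a classical environment register no later than the cut (possibly revealed afterwards). $\mathsf{Fresh}(z,\omega,x)\in\{0,1\}$ is deterministic, oracle independent, and fixed from the cut onward. BAD NORM. Represent the random oracle by its purified compressed oracle (Zhandry), whose database register has an orthonormal basis of partial functions $D:\mathcal X\to\mathcal Y\cup\{\bot\}$, with $\operatorname{dom}(D)=\{x:D(x)\ne\bot\}$. Set $\mathsf{Hit}_{z,\omega,C}(D)=1$ iff there is $x\in\operatorname{dom}(D)$ with $\mathsf{Fresh}(z,\omega,x)=1$ and $D(x)\in C$. The purified state at the adaptive cut is a direct sum over classical branches $|\Psi_\Theta\rangle=\bigoplus_{\theta,z,\omega,C}|\theta,z,\omega,C\rangle|\psi_{\theta,z,\omega,C}\rangle$ (subnormalized branch states; branches where the cut never occurs contribute zero to the hit projector). $\Pi_{\mathsf{Hit}}$ is the branch-controlled projector onto databases satisfying $\mathsf{Hit}$, and $\beta_{\mathsf{cut}}=\|\Pi_{\mathsf{Hit}}|\Psi_\Theta\rangle\|$. The projector is analytic only; it is not measured in the experiment. *)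

(* Defs.v *)
From mathcomp Require Import all_boot all_order all_algebra.
From mathcomp Require Import complex reals.
From Stdlib Require List.

Set Implicit Arguments.
Unset Strict Implicit.
Unset Printing Implicit Defensive.

Import Order.TTheory GRing.Theory Num.Theory.
Import ComplexField.Normc.
Local Open Scope ring_scope.

(** * Oracle range, signatures, programs *)

(* {0,1}^lambda; addition is bitwise exclusive or. *)
Notation bits lambda := 'rV['F_2]_lambda.

Record signature := Signature {
  secpar : nat;       (* lambda *)
  dom : finType;      (* oracle inputs *)
  cmd : finType;      (* contents of the interface message register *)
  wsp : finType;      (* basis labels of the remaining adversarial workspace *)
  emission : Type;    (* public emissions: responses, receipts, certificates,
                         public coins *)
  private : Type;     (* private state of the environment *)
  hidden : Type       (* contents of the hidden register omega *)
}.

Notation rng S := (bits (secpar S)).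

(* Computational basis |x, z, m, w> of the adversary: query input, query
   output, interface message register, workspace. *)
Definition basis (S : signature) : finType :=
  (dom S * rng S * cmd S * wsp S)%type.

(* The number of ticks is the public clock: [Tick] closes the current slot. *)
Inductive event (S : signature) := Emit of emission S | Tick.
Arguments Tick {S}.

Definition transcript (S : signature) := seq (event S).

Definition clock S (T : transcript S) : nat :=
  count (fun e => if e is Tick then true else false) T.

Inductive eval_kind := Mediated | Honest | Check.

Definition is_check (k : eval_kind) := if k is Check then true else false.

Definition is_distr (R : realType) n (mu : 'I_n -> R) : bool :=
  [forall i, 0 <= mu i] && (\sum_i mu i == 1).

(* Classical processing of one interface call by the environment.
   [EAccept J m] is the winning acceptance: its retained validation history
   consists of the entries of the check register at the positions [J], and
   the retained checks selected by the mask [m] are those which witness it. *)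
Inductive eprog (R : realType) (S : signature) :=
| ERet of private S
| EEmit of emission S & eprog R S
| ETick of eprog R S
| EHide of hidden S & eprog R S
| ESample n (mu : 'I_n -> R) of is_distr mu & ('I_n -> eprog R S)
| EEval of eval_kind & dom S & (rng S -> eprog R S)
| EAccept of seq nat & bitseq.

(* The adversary. [ACall] hands the message register over to be measured and
   continues with the events published while the call was processed.
   Measurements internal to the adversary are deferred into its workspace. *)
Inductive adversary (R : realType) (S : signature) :=
| AHalt
| AUnitary (U : 'M[R[i]]_#|basis S|) of U \is unitarymx & adversary R S
| AQuery of adversary R S
| ACall of (seq (event S) -> adversary R S).

Record ledger (S : signature) := Ledger {
  lstate : Type;      (* clock, pending pool, public ledger state *)
  linit : lstate;
  ltrans : lstate -> event S -> lstate;
  lfinal : lstate -> nat   (* length of the finalized transcript prefix *)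
}.

Definition ledger_at S (L : ledger S) (T : transcript S) : lstate L :=
  foldl (@ltrans _ L) (linit L) T.

Definition finalized S (L : ledger S) (T : transcript S) : transcript S :=
  take (lfinal (ledger_at L T)) T.

(* The amplitude of the output basis state (z', o') when x is evaluated on
   (z, o) is [okern x (z, o) (z', o')], with o ranging over the basis of the
   oracle register. *)
Record oracle (R : realType) (S : signature) := Oracle {
  oreg : finType;
  oinit : oreg -> R[i];
  okern : dom S -> rng S * oreg -> rng S * oreg -> R[i]
}.

Record execution (R : realType) (S : signature) := Execution {
  machine : ledger S;
  env : lstate machine -> private S -> cmd S -> eprog R S;
  priv0 : private S;
  hidden0 : hidden S;
  adv : adversary R S;
  amp0 : basis S -> R[i];
  amp0_unit : \sum_b normc (amp0 b) ^+ 2 = 1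
}.

(* The stopping time is given by the events {Theta = t}, each a predicate of
   the public transcript through slot t: Theta is the first slot whose closing
   transcript satisfies [stop]. *)
Record cut_rule (S : signature) := CutRule {
  stop : pred (transcript S);
  target : transcript S -> {set rng S}   (* the map g *)
}.

(** * Classical branch data *)

Record cut_data (S : signature) := CutData {
  cut_slot : nat;
  cut_transcript : transcript S;
  cut_hidden : hidden S;
  cut_target : {set rng S}
}.

Record check_entry (S : signature) := CheckEntry {
  ck_point : dom S;
  ck_value : rng S;
  ck_after_cut : bool
}.

Record acceptance (S : signature) := Acceptance {
  retained : seq (check_entry S);
  witnesses : seq (check_entry S)
}.

Record branch (S : signature) := Branch {
  pub : transcript S;
  priv : private S;
  hid : hidden S;
  cut : option (cut_data S);
  evals_after_cut : nat;
  checks : seq (check_entry S);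
  accepted : option (acceptance S)
}.

Definition branch0 R S (E : execution R S) : branch S :=
  Branch [::] (priv0 E) (hidden0 E) None 0 [::] None.

Section Updates.
Context (S : signature) (L : ledger S) (rule : cut_rule S).
Implicit Type b : branch S.

Definition set_priv s b :=
  Branch (pub b) s (hid b) (cut b) (evals_after_cut b) (checks b) (accepted b).

Definition set_hid w b :=
  Branch (pub b) (priv b) w (cut b) (evals_after_cut b) (checks b) (accepted b).

Definition emit p b :=
  Branch (rcons (pub b) (Emit p)) (priv b) (hid b) (cut b) (evals_after_cut b)
    (checks b) (accepted b).

Definition take_cut b (T : transcript S) : option (cut_data S) :=
  match cut b with
  | Some c => Some c
  | None => if stop rule T then
              Some (CutData (clock (pub b)) T (hid b)
                            (target rule (finalized L T)))
            else None
  end.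

Definition tick b :=
  let T := rcons (pub b) Tick in
  Branch T (priv b) (hid b) (take_cut b T) (evals_after_cut b) (checks b)
    (accepted b).

Definition count_eval b :=
  Branch (pub b) (priv b) (hid b) (cut b) (isSome (cut b) + evals_after_cut b)
    (checks b) (accepted b).

Definition log_eval (k : eval_kind) x y b :=
  let b := count_eval b in
  if is_check k then
    Branch (pub b) (priv b) (hid b) (cut b) (evals_after_cut b)
      (rcons (checks b) (CheckEntry x y (isSome (cut b)))) (accepted b)
  else b.

Definition accept (J : seq nat) (m : bitseq) b :=
  let r := pmap (onth (checks b)) J in
  Branch (pub b) (priv b) (hid b) (cut b) (evals_after_cut b) (checks b)
    (Some (Acceptance r (mask m r))).

End Updates.

(** * Quantum semantics *)

Section Semantics.
Context (R : realType) (S : signature) (O : oracle R S).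

(* Unnormalized vectors of the adversary and the oracle register. *)
Definition state := {ffun basis S * oreg O -> R[i]}.
Implicit Type psi : state.

Definition sqnorm psi : R := \sum_bo normc (psi bo) ^+ 2.

Definition op_init (a : basis S -> R[i]) : state :=
  [ffun bo => a bo.1 * oinit bo.2].

Definition op_unitary (U : 'M[R[i]]_#|basis S|) psi : state :=
  [ffun bo => \sum_c U (enum_rank bo.1) (enum_rank c) * psi (c, bo.2)].

Definition op_query psi : state :=
  [ffun bo => let: (x, z, m, w) := bo.1 in
     \sum_(zo : rng S * oreg O)
        okern x zo (z, bo.2) * psi ((x, zo.1, m, w), zo.2)].

Definition op_measure (m : cmd S) psi : state :=
  [ffun bo => if bo.1.1.2 == m then psi bo else 0].

(* Evaluation on the classical input x: the oracle is applied to x and a fresh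
   output register |0>, which is then measured with outcome y. *)
Definition op_eval (x : dom S) (y : rng S) psi : state :=
  [ffun bo => \sum_(o : oreg O) okern x (0, o) (y, bo.2) * psi (bo.1, o)].

Definition op_scale (a : R) psi : state :=
  [ffun bo => real_complex R a * psi bo].

(* A run is the list of its classical branches, each with its subnormalized
   vector; branches for which [halt] holds are left as they are. *)
Fixpoint run_env (L : ledger S) (rule : cut_rule S) (halt : pred (branch S))
    (p : eprog R S) (b : branch S) (psi : state) : seq (branch S * state) :=
  if halt b then [:: (b, psi)] else
  match p with
  | ERet s => [:: (set_priv s b, psi)]
  | EEmit e p => run_env L rule halt p (emit e b) psi
  | ETick p => run_env L rule halt p (tick L rule b) psi
  | EHide w p => run_env L rule halt p (set_hid w b) psi
  | ESample n mu _ p =>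
      flatten [seq run_env L rule halt (p i) b
                 (op_scale (Num.sqrt (mu i)) psi) | i <- enum 'I_n]
  | EEval k x p =>
      flatten [seq run_env L rule halt (p y) (log_eval k x y b)
                 (op_eval x y psi) | y <- enum {: rng S}]
  | EAccept J m => [:: (accept J m b, psi)]
  end.

Fixpoint run_adv (E : execution R S) (rule : cut_rule S)
    (halt : pred (branch S)) (a : adversary R S) (b : branch S) (psi : state)
    : seq (branch S * state) :=
  if halt b then [:: (b, psi)] else
  match a with
  | AHalt => [:: (b, psi)]
  | AUnitary U _ a => run_adv E rule halt a b (op_unitary U psi)
  | AQuery a => run_adv E rule halt a (count_eval b) (op_query psi)
  | ACall a =>
      flatten [seq
        flatten [seq run_adv E rule halt (a (drop (size (pub b)) (pub r.1)))
                   r.1 r.2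
                | r <- run_env (machine E) rule halt
                         (env (ledger_at (machine E) (pub b)) (priv b) m)
                         b (op_measure m psi)]
        | m <- enum (cmd S)]
  end.

Definition run (E : execution R S) (rule : cut_rule S)
    (halt : pred (branch S)) : seq (branch S * state) :=
  run_adv E rule halt (adv E) (branch0 E) (op_init (@amp0 _ _ E)).

End Semantics.

(* The experiment is followed up to the first winning acceptance, so that the
   counted evaluations are those which may influence it. *)
Definition at_acceptance S (b : branch S) : bool := isSome (accepted b).

Definition at_cut S (b : branch S) : bool :=
  isSome (accepted b) || isSome (cut b).

(** * The two oracles *)

Definition real_oracle (R : realType) (S : signature)
    (H : {ffun dom S -> rng S}) : oracle R S :=
  @Oracle R S unit (fun=> 1)
    (fun x zo zo' => (zo'.1 == zo.1 + H x)%:R).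

Definition database (S : signature) : finType := {ffun dom S -> option (rng S)}.

(* Matrix of the (self-adjoint) local decompression on C[Y + bot]: it swaps
   |bot> with the uniform superposition 2^(-lambda/2) sum_y |y> and is the
   identity on the orthogonal complement of these two vectors. *)
Definition decomp (R : realType) (S : signature) (d d' : option (rng S))
    : R[i] :=
  let N : R := 2 ^+ secpar S in
  real_complex R
    match d, d' with
    | None, None => 0
    | None, Some _ | Some _, None => (Num.sqrt N)^-1
    | Some y, Some y' => (y == y')%:R - N^-1
    end.

(* One query to Zhandry's compressed oracle: decompress at x, add the entry to
   the output register (with z + bot = z), compress at x. *)
Definition compressed_kern (R : realType) (S : signature) (x : dom S)
    (zD zD' : rng S * database S) : R[i] :=
  if [forall x', (x' != x) ==> (zD'.2 x' == zD.2 x')] then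
    \sum_(e : option (rng S))
       decomp R (zD'.2 x) e * (zD'.1 == zD.1 + odflt 0 e)%:R
         * decomp R e (zD.2 x)
  else 0.

Definition compressed_oracle (R : realType) (S : signature) : oracle R S :=
  @Oracle R S (database S) (fun D => (D == [ffun=> None])%:R)
    (@compressed_kern R S).

(** * Bad norm, winning probability, hypotheses on branches *)

Definition freshness (S : signature) :=
  transcript S -> hidden S -> dom S -> bool.

Definition cut_fresh S (Fresh : freshness S) (c : cut_data S) (x : dom S) :=
  Fresh (cut_transcript c) (cut_hidden c) x.

Definition Hit S (Fresh : freshness S) (c : cut_data S) (D : database S)
    : bool :=
  [exists x, cut_fresh Fresh c x &&
     (if D x is Some y then y \in cut_target c else false)].

Definition project_hit (R : realType) S (Fresh : freshness S) (c : cut_data S)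
    (psi : state (compressed_oracle R S)) : state (compressed_oracle R S) :=
  [ffun bD => if Hit Fresh c bD.2 then psi bD else 0].

Definition beta_cut (R : realType) S (E : execution R S) (rule : cut_rule S)
    (Fresh : freshness S) : R :=
  Num.sqrt (\sum_(r <- run (compressed_oracle R S) E rule (@at_cut S))
    if cut r.1 is Some c then sqnorm (project_hit Fresh c r.2) else 0).

(* W is the event that a winning acceptance occurs, H being uniform. *)
Definition Pr_W (R : realType) S (E : execution R S) (rule : cut_rule S) : R :=
  (#|{ffun dom S -> rng S}|%:R)^-1 *
  \sum_(H : {ffun dom S -> rng S})
    \sum_(r <- run (real_oracle R H) E rule (@at_acceptance S)
             | isSome (accepted r.1)) sqnorm r.2.

(* [b] is a final branch of non-zero probability given H. *)
Definition possible (R : realType) S (E : execution R S) (rule : cut_rule S)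
    (H : {ffun dom S -> rng S}) (b : branch S) : Prop :=
  exists2 psi, List.In (b, psi) (run (real_oracle R H) E rule (@at_acceptance S))
             & sqnorm psi != 0.

Section Hypotheses.
Context (R : realType) (S : signature) (E : execution R S) (rule : cut_rule S).

Definition cut_bounded (K : nat) : Prop :=
  forall H b c, possible E rule H b -> cut b = Some c ->
  (#|cut_target c| <= K)%N.

Definition cut_closed : Prop :=
  forall H b c a, possible E rule H b -> cut b = Some c ->
  accepted b = Some a ->
  forall e, List.In e (witnesses a) -> H (ck_point e) \in cut_target c.

Definition W_needs_cut : Prop :=
  forall H b, possible E rule H b -> isSome (accepted b) -> isSome (cut b).

Definition checks_follow_cut : Prop :=
  forall H b a, possible E rule H b -> accepted b = Some a ->
  forall e, List.In e (retained a) -> ck_after_cut e.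

Definition W_has_fresh_hit (Fresh : freshness S) (ell : nat) : Prop :=
  forall H b c a, possible E rule H b -> cut b = Some c ->
  accepted b = Some a ->
  (size (retained a) <= ell)%N /\
  exists2 e, List.In e (retained a) &
    cut_fresh Fresh c (ck_point e) /\ H (ck_point e) \in cut_target c.

Definition post_cut_budget (Q : nat) : Prop :=
  forall H b, possible E rule H b -> (evals_after_cut b <= Q)%N.

End Hypotheses.

(* Main.v *)
Require Import Defs.
From mathcomp Require Import all_boot all_order all_algebra.
From mathcomp Require Import complex reals.
From mathcomp Require Import ring lra.
From Stdlib Require List.
Import Order.TTheory GRing.Theory Num.Theory.
Import ComplexField.Normc.
Local Open Scope ring_scope.
Set Implicit Arguments.
Unset Strict Implicit.
Unset Printing Implicit Defensive.

(* Purify the uniform oracle into a superposition of all functions. Compressing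
   every coordinate is an isometry onto the states of the compressed oracle
   which commutes with each step of the execution, so both runs have the same
   classical branches with the same weights. After the cut one evaluation
   moves amplitude from databases without a hit to databases with a hit by at
   most sqrt(10 K / 2^lambda), and Minkowski's inequality lets these increments
   add up along the tree of classical branches. On an accepted branch the
   purified state is supported on functions with H x = y for some retained fresh
   check (x, y) with y in C; compressing the basis state y loses weight at most
   2 / 2^lambda on databases with D x <> y, so all but this fraction of the
   branch lies in the hit subspace. *)

(** * One query at a single coordinate *)

(** The hypotheses concern runs with one fixed [H], whereas hits are properties of databases. The
    purified oracle stands between the two: its component at [H] is the run with that [H], its
    compression is the compressed run, and both maps leave the list of classical branches unchanged,
    so facts about real runs can be used branch by branch. A run also lists branches whose vector is
    zero, and on these the hypotheses say nothing; the predicate [good] and the premise [psi != 0]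
    in [consistent] keep them out of the estimates.

    The constant 10 arises at one database entry. What a query moves into a given value [y'] depends
    only on the parts of the amplitudes that have mean zero over the output register. The empty
    entry contributes with weight 1, the three shifted copies of the filled entries with weight 9,
    and every target value costs 10 / 2^lambda.

    The final loss is paid once per branch: the check that shows the hit is stored in the classical
    branch, hence is the same for all functions in its support. *)

Lemma sum_delta (V : pzSemiRingType) (T : finType) (y : T) (F : T -> V) :
  \sum_y' (y' == y)%:R * F y' = F y.
Proof.
rewrite (bigD1 y) //= eqxx mul1r big1 ?addr0 // => i /negbTE ->; exact: mul0r.
Qed.

Section RealSums.
Context (R : realType).

(** Cauchy-Schwarz against the constant vector: twice the difference of the two sides is the sum of
    [(f i - f j) ^+ 2] over all pairs. *)
Lemma sqr_sum_le (I : finType) (f : I -> R) :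
  (\sum_i f i) ^+ 2 <= #|I|%:R * \sum_i f i ^+ 2.
Proof.
have H : 0 <= \sum_i \sum_j (f i - f j) ^+ 2.
  by apply: sumr_ge0 => i _; apply: sumr_ge0 => j _; apply: sqr_ge0.
have E : \sum_i \sum_j (f i - f j) ^+ 2
  = (#|I|%:R * \sum_i f i ^+ 2) *+ 2 - ((\sum_i f i) ^+ 2) *+ 2.
  transitivity (\sum_i \sum_j (f i ^+ 2 + f j ^+ 2 - (f i * f j) *+ 2)).
    by apply: eq_bigr => i _; apply: eq_bigr => j _; ring.
  under eq_bigr => i _ do rewrite sumrB big_split /= sumr_const sumrMnl -mulr_sumr.
  rewrite sumrB big_split /= !sumrMnl sumr_const -mulr_suml.
  ring.
by move: H; rewrite E subr_ge0 lerMn2r.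
Qed.

Definition mean (G : finType) (f : G -> R) : R := #|G|%:R^-1 * \sum_z f z.

(** Subtracting the mean removes the component along the constant vector, which can only shorten
    [f]. *)
Lemma sum_sqr_centered_le (G : finType) (f : G -> R) :
  \sum_z (f z - mean f) ^+ 2 <= \sum_z f z ^+ 2.
Proof.
have [G0|Gpos] := posnP #|G|.
  rewrite !big_pred0 // => z; exact: (card0_eq G0).
have n0 : #|G|%:R != 0 :> R by rewrite pnatr_eq0 -lt0n.
have -> : \sum_z (f z - mean f) ^+ 2 = \sum_z f z ^+ 2 - #|G|%:R * mean f ^+ 2.
  transitivity (\sum_z (f z ^+ 2 + mean f ^+ 2 - (f z * mean f) *+ 2)).
    by apply: eq_bigr => z _; ring.
  rewrite sumrB big_split /= sumr_const sumrMnl -mulr_suml -mulr_natl.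
  have -> : \sum_z f z = #|G|%:R * mean f by rewrite /mean mulrA divff ?mul1r.
  ring.
by rewrite lerBlDr lerDl mulr_ge0 ?ler0n ?sqr_ge0.
Qed.

End RealSums.

Section Local.
Context (R : realType) (S : signature).

Let N : R := 2 ^+ secpar S.

Lemma card_rng : #|rng S|%:R = N :> R.
Proof. by rewrite card_mx card_Fp // mul1n natrX. Qed.

Lemma range_size_gt0 : 0 < N. Proof. by rewrite exprn_gt0. Qed.
Lemma range_size_neq0 : N != 0. Proof. by rewrite gt_eqF ?range_size_gt0. Qed.

(** The kernels of the compressed oracle have real entries, so the estimates are made over the
    ordered field [R] and then applied to real and imaginary parts separately. *)
Definition rdecomp (d d' : option (rng S)) : R :=
  match d, d' with
  | None, None => 0
  | None, Some _ | Some _, None => (Num.sqrt N)^-1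
  | Some y, Some y' => (y == y')%:R - N^-1
  end.

Lemma decompE d d' : decomp R d d' = real_complex R (rdecomp d d').
Proof. by []. Qed.

Lemma rdecompC d d' : rdecomp d d' = rdecomp d' d.
Proof. by case: d d' => [y|] [y'|] //=; rewrite eq_sym. Qed.

Lemma sum_option (T : finType) (F : option T -> R) :
  \sum_d F d = F None + \sum_y F (Some y).
Proof.
rewrite (bigD1 None) //=; congr (_ + _).
rewrite (reindex_omap Some id) /=; last by case.
by apply: eq_bigl => y; rewrite eqxx.
Qed.

Lemma invsqrt_range_size : (Num.sqrt N)^-1 * (Num.sqrt N)^-1 = N^-1.
Proof. by rewrite -invfM -expr2 sqr_sqrtr // ltW // range_size_gt0. Qed.

Lemma sum_rng_const (c : R) : \sum_(y : rng S) c = N * c.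
Proof. by rewrite sumr_const -mulr_natl card_rng. Qed.

(** The matrix is the Householder reflection I - v v^T for v = |bot> - N^(-1/2) sum_y |y>, a vector
    of squared norm 2. *)
Lemma rdecomp_invol d d' : \sum_e rdecomp d e * rdecomp e d' = (d == d')%:R.
Proof.
have N0 := range_size_neq0.
have E (y : rng S) : \sum_e ((y == e)%:R - N^-1) = 0 :> R.
  rewrite sumrB sum_rng_const divff // (eq_bigr (fun e => (e == y)%:R * 1)).
    by rewrite sum_delta subrr.
  by move=> e _; rewrite mulr1 eq_sym.
rewrite sum_option; case: d d' => [y|] [y'|] /=.
- rewrite invsqrt_range_size /= (inj_eq Some_inj).
  transitivity (N^-1 + (\sum_e (e == y)%:R * ((e == y')%:R - N^-1)
                        - N^-1 * \sum_e ((y' == e)%:R - N^-1))).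
    congr (_ + _); rewrite mulr_sumr -sumrB; apply: eq_bigr => e _.
    by rewrite [y' == e]eq_sym [y == e]eq_sym; ring.
  by rewrite sum_delta E mulr0 subr0 addrC subrK.
- by rewrite mulr0 add0r -mulr_suml E mul0r.
- rewrite mul0r add0r -mulr_sumr.
  under eq_bigr => e _ do rewrite eq_sym.
  by rewrite E mulr0.
- by rewrite mul0r add0r invsqrt_range_size sum_rng_const divff.
Qed.

Lemma sum_rng_shift (y : rng S) (F : rng S -> R) : \sum_z F (z - y) = \sum_z F z.
Proof.
rewrite (reindex_inj (addIr y)) /=; apply: eq_bigr => z _; by rewrite addrK.
Qed.

(* [a z d] is the amplitude of output register [z] and database entry [d]. *)
Definition local_query (a : rng S -> option (rng S) -> R) z d' : R :=
  \sum_e rdecomp d' e * \sum_d rdecomp e d * a (z - odflt 0 e) d.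

(* Only the centered parts [b] of the amplitudes enter the hit component, since
   averaging over [z] absorbs every shift. *)
Lemma local_queryE (a : rng S -> option (rng S) -> R) y' z :
  (forall z, a z (Some y') = 0) ->
  let b d z := a z d - mean (a^~ d) in
  local_query a z (Some y') =
  (Num.sqrt N)^-1 * b None (z - y')
  + N^-1 * \sum_y (b (Some y) z - b (Some y) (z - y') - b (Some y) (z - y)).
Proof.
move=> a0 b; have N0 := range_size_neq0.
set s := (Num.sqrt N)^-1.
have F z' e : \sum_d rdecomp (Some e) d * a z' d
    = s * a z' None + a z' (Some e) - N^-1 * \sum_y a z' (Some y).
  rewrite sum_option /= -addrA; congr (_ + _).
  transitivity (\sum_y ((y == e)%:R * a z' (Some y) - N^-1 * a z' (Some y))).
    by apply: eq_bigr => y _; rewrite mulrBl eq_sym.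
  by rewrite sumrB sum_delta -mulr_sumr.
have F0 z' : \sum_d rdecomp None d * a z' d = s * \sum_y a z' (Some y).
  by rewrite sum_option /= mul0r add0r -mulr_sumr.
rewrite /local_query sum_option /= F0 subr0 mulrA invsqrt_range_size.
transitivity (N^-1 * (\sum_y a z (Some y)) +
  ((s * a (z - y') None + a (z - y') (Some y') - N^-1 * \sum_y a (z - y') (Some y))
   - N^-1 * \sum_e (s * a (z - e) None + a (z - e) (Some e)
                    - N^-1 * \sum_y a (z - e) (Some y)))).
  congr (_ + _).
  pose G e := s * a (z - e) None + a (z - e) (Some e)
              - N^-1 * \sum_y a (z - e) (Some y).
  rewrite -/(G y') -[X in X - _](sum_delta y' G) mulr_sumr -sumrB.
  by apply: eq_bigr => e _; rewrite F -/(G e) eq_sym mulrBl.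
rewrite a0 addr0 [X in _ - _ * X]sumrB big_split /= -!mulr_sumr.
have shift d : \sum_e a (z - e) d = N * mean (a^~ d).
  rewrite /mean card_rng mulrA divff // mul1r.
  rewrite (reindex_inj (inj_comp (addrI z) oppr_inj)) /=.
  by apply: eq_bigr => e _; rewrite opprB addrC subrK.
rewrite shift exchange_big /=.
under [X in _ - _ * (_ - _ * X)]eq_bigr => y _ do rewrite shift.
rewrite -mulr_sumr.
(* Centering: the double sum contributes one mean for each [Some y], which is what the signs +, -, -
   leave over in the three shifted copies. *)
transitivity (s * (a (z - y') None - mean (a^~ None)) + N^-1 *
  (\sum_y a z (Some y) - \sum_y a (z - y') (Some y) - \sum_y a (z - y) (Some y)
   + \sum_y mean (a^~ (Some y)))); first by field.
congr (_ + _ * _); rewrite -!sumrB -big_split /=.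
by apply: eq_bigr => y _; rewrite /b; ring.
Qed.

Lemma local_query_hit (a : rng S -> option (rng S) -> R) y' :
  (forall z, a z (Some y') = 0) ->
  \sum_z local_query a z (Some y') ^+ 2 <= 10 / N * \sum_z \sum_d a z d ^+ 2.
Proof.
move=> a0; have N0 := range_size_neq0; have Np := range_size_gt0.
set b := fun d z => a z d - mean (a^~ d).
have bnd z : local_query a z (Some y') ^+ 2 <=
    10 / N * (b None (z - y') ^+ 2 + 3^-1 * \sum_y (b (Some y) z ^+ 2
      + b (Some y) (z - y') ^+ 2 + b (Some y) (z - y) ^+ 2)).
  (* 10 = 1 + 9: Cauchy-Schwarz for the entry [None] and the three shifted
     copies of the entries [Some y]. *)
  rewrite local_queryE // -/b.
  set u := b None _; set V := \sum_y _; set W := \sum_y _.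
  have VW : V ^+ 2 <= N * 3 * W.
    rewrite -mulrA -card_rng; apply: le_trans (sqr_sum_le _) _.
    rewrite ler_wpM2l ?ler0n // mulr_sumr ler_sum // => y _.
    have aux (p q r : R) : (p - q - r) ^+ 2 <= 3 * (p ^+ 2 + q ^+ 2 + r ^+ 2).
      have := sqr_ge0 (p + q); have := sqr_ge0 (p + r); have := sqr_ge0 (q - r).
      by rewrite !expr2; lra.
    exact: aux.
  set s := (Num.sqrt N)^-1; have s2 : N^-1 = s * s by rewrite invsqrt_range_size.
  (* Weighted Cauchy-Schwarz with weights 1 and 9. The 9 balances the second term: the three
     summands of [V] cost a factor 3, and their three norms another 3. *)
  apply: (@le_trans _ _ (10 * ((s * u) ^+ 2 + 9^-1 * (N^-1 * V) ^+ 2))).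
    set x := s * u; set y := N^-1 * V; have := sqr_ge0 (3 * x - 3^-1 * y); nra.
  have -> : (s * u) ^+ 2 = N^-1 * u ^+ 2 by rewrite s2; ring.
  have -> : (N^-1 * V) ^+ 2 = N^-1 * (N^-1 * V ^+ 2) by ring.
  have : N^-1 * V ^+ 2 <= 3 * W.
    by rewrite mulrC ler_pdivrMr // mulrC mulrA.
  have : 0 < N^-1 by rewrite invr_gt0.
  set M := N^-1; set X := M * V ^+ 2 => Mp XW.
  have : M * X <= M * (3 * W) by rewrite ler_pM2l.
  lra.
apply: le_trans (ler_sum _ (fun z _ => bnd z)) _.
rewrite -mulr_sumr ler_wpM2l //; first by rewrite divr_ge0 ?ltW.
rewrite big_split /= (sum_rng_shift y' (fun z => b None z ^+ 2)) -mulr_sumr.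
rewrite exchange_big /= [X in _ <= X]exchange_big sum_option /= lerD ?sum_sqr_centered_le //.
rewrite mulr_sumr ler_sum // => y _.
rewrite !big_split /= (sum_rng_shift y' (fun z => b (Some y) z ^+ 2))
  (sum_rng_shift y (fun z => b (Some y) z ^+ 2)).
have := sum_sqr_centered_le (a^~ (Some y)).
rewrite -/(b _); set X := \sum_z b _ _ ^+ 2; set Y := \sum_z _ => H.
have XY : X <= Y by []. 
lra.
Qed.

End Local.

(** * Queries to the compressed oracle *)

Section ComplexLift.
Context (R : realType).

Lemma normc2E (z : R[i]) : normc z ^+ 2 = complex.Re z ^+ 2 + complex.Im z ^+ 2.
Proof. by case: z => a b /=; rewrite sqr_sqrtr // addr_ge0 ?sqr_ge0. Qed.

Lemma normc2_real_sum (J : finType) (k : J -> R) (v : J -> R[i]) :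
  normc (\sum_j real_complex R (k j) * v j) ^+ 2
    = (\sum_j k j * complex.Re (v j)) ^+ 2 + (\sum_j k j * complex.Im (v j)) ^+ 2.
Proof.
rewrite normc2E !raddf_sum /=.
by congr (_ ^+ 2 + _ ^+ 2); apply: eq_bigr => j _; case: (v j) => p q /=;
  rewrite mul0r ?subr0 ?addr0.
Qed.

(** A real kernel acts on real and imaginary parts independently, so the constant [M] survives. The
    predicates [P] and [supp] let one statement serve both norm bounds and transitions from no hit
    to a hit. *)
Lemma real_kernel_bound (I J : finType) (P : pred I) (supp : pred J)
    (k : I -> J -> R) (M : R) (v : J -> R[i]) :
  (forall u : J -> R, (forall j, ~~ supp j -> u j = 0) ->
     \sum_(i | P i) (\sum_j k i j * u j) ^+ 2 <= M * \sum_j u j ^+ 2) ->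
  (forall j, ~~ supp j -> v j = 0) ->
  \sum_(i | P i) normc (\sum_j real_complex R (k i j) * v j) ^+ 2
    <= M * \sum_j normc (v j) ^+ 2.
Proof.
move=> kM v0.
under eq_bigr => i _ do rewrite normc2_real_sum.
under [X in _ <= _ * X]eq_bigr => j _ do rewrite normc2E.
rewrite !big_split /= mulrDr lerD // kM // => j /v0 -> //.
Qed.

End ComplexLift.

Section Database.
Context (R : realType) (S : signature).
Implicit Types (D : database S) (x : dom S) (d : option (rng S)).

Definition upd D x d : database S := [ffun x' => if x' == x then d else D x'].

Lemma upd_at D x d : upd D x d x = d.
Proof. by rewrite ffunE eqxx. Qed.

Lemma upd_other D x d x' : x' != x -> upd D x d x' = D x'.
Proof. by rewrite ffunE => /negbTE ->. Qed.

Lemma upd_id D x : upd D x (D x) = D.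
Proof. by apply/ffunP => x'; rewrite ffunE; case: eqP => // ->. Qed.

Lemma upd_upd D x d d' : upd (upd D x d) x d' = upd D x d'.
Proof. by apply/ffunP => x'; rewrite !ffunE; case: eqP. Qed.

(** Databases fibre over those undefined at [x], the fibre being the possible entries at [x]. A
    query at [x] stays within each fibre. *)
Lemma sum_database (V : nmodType) x (F : database S -> V) :
  \sum_D F D = \sum_(D : database S | D x == None) \sum_d F (upd D x d).
Proof.
rewrite pair_big_dep /= (reindex_onto (fun p => upd p.1 x p.2)
  (fun D : database S => (upd D x None, D x))) /=; last by move=> D _; rewrite upd_upd upd_id.
apply: eq_bigl => -[D d] /=; rewrite upd_at upd_upd andbT xpair_eqE eqxx andbT.
apply/eqP/eqP => [<-|Dx]; first by rewrite upd_at.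
by rewrite -{1}Dx upd_id.
Qed.

Definition rkern x (zD zD' : rng S * database S) : R :=
  if [forall x', (x' != x) ==> (zD'.2 x' == zD.2 x')] then
    \sum_(e : option (rng S))
       rdecomp R (zD'.2 x) e * (zD'.1 == zD.1 + odflt 0 e)%:R
         * rdecomp R e (zD.2 x)
  else 0.

Lemma compressed_kernE x zD zD' :
  compressed_kern R x zD zD' = real_complex R (rkern x zD zD').
Proof.
rewrite /compressed_kern /rkern; case: ifP => _; last by rewrite rmorph0.
rewrite rmorph_sum; apply: eq_bigr => e _.
by rewrite !rmorphM /= !decompE rmorph_nat.
Qed.

Lemma forall_updE D D' x :
  [forall x', (x' != x) ==> (D' x' == D x')] = (D == upd D' x (D x)).
Proof.
apply/forallP/eqP => [H|->].
  apply/ffunP => x'; rewrite ffunE; case: eqP => [-> //|/eqP ne].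
  by have /implyP/(_ ne)/eqP := H x'.
by move=> x'; apply/implyP => ne; rewrite upd_other.
Qed.

(** The kernel vanishes unless both databases agree off [x], and for each decompressed entry [e]
    only [z = z' - e] survives. *)
Lemma rkern_local x (u : rng S * database S -> R) z' D' :
  \sum_zD rkern x zD (z', D') * u zD
    = local_query (fun z d => u (z, upd D' x d)) z' (D' x).
Proof.
rewrite (eq_bigr (fun p => rkern x (p.1, p.2) (z', D') * u (p.1, p.2)));
  last by case.
rewrite -(pair_bigA _ (fun z D => rkern x (z, D) (z', D') * u (z, D))) /=.
transitivity (\sum_z \sum_d \sum_e rdecomp R (D' x) e * (z' == z + odflt 0 e)%:R
    * rdecomp R e d * u (z, upd D' x d)).
  apply: eq_bigr => z _.
  rewrite (bigID [pred D : database S | D == upd D' x (D x)]) /= [X in _ + X]big1 ?addr0; last first.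
    by move=> D /negbTE ne; rewrite /rkern /= forall_updE ne mul0r.
  rewrite (reindex_onto (upd D' x) (fun D : database S => D x)) /=; last by move=> D /eqP {2}->.
  apply: eq_big => [d|d _]; first by rewrite upd_at !eqxx.
  by rewrite /rkern /= forall_updE upd_at eqxx mulr_suml.
rewrite /local_query; under eq_bigr => z _ do rewrite exchange_big.
rewrite exchange_big /=; apply: eq_bigr => e _.
rewrite (bigD1 (z' - odflt 0 e)) //= [X in _ + X]big1 ?addr0; last first.
  move=> z ne; apply: big1 => d _; rewrite -subr_eq eq_sym (negbTE ne).
  by rewrite mulr0 !mul0r.
by rewrite mulr_sumr; apply: eq_bigr => d _; rewrite subrK eqxx mulr1 mulrA.
Qed.

Lemma sum_rdecomp_sqr (g : option (rng S) -> R) :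
  \sum_d (\sum_e rdecomp R d e * g e) ^+ 2 = \sum_e g e ^+ 2.
Proof.
transitivity (\sum_d \sum_e \sum_e' rdecomp R e d * rdecomp R d e' * (g e * g e')).
  apply: eq_bigr => d _; rewrite expr2 mulr_suml; apply: eq_bigr => e _.
  by rewrite mulr_sumr; apply: eq_bigr => e' _; rewrite [rdecomp R e d]rdecompC; ring.
rewrite exchange_big; apply: eq_bigr => e _; rewrite exchange_big /=.
transitivity (\sum_e' (e' == e)%:R * (g e * g e')).
  by apply: eq_bigr => e' _; rewrite -mulr_suml rdecomp_invol eq_sym.
by rewrite sum_delta expr2.
Qed.

(** Three norm-preserving maps in turn: [rdecomp] on the entry, a translation of the output register
    depending on the entry alone, and [rdecomp] again. *)
Lemma local_query_norm (a : rng S -> option (rng S) -> R) :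
  \sum_z \sum_d local_query a z d ^+ 2 = \sum_z \sum_d a z d ^+ 2.
Proof.
under eq_bigr => z _ do rewrite sum_rdecomp_sqr.
rewrite exchange_big /=.
under eq_bigr => e _ do
  rewrite (sum_rng_shift (odflt 0 e) (fun z => (\sum_d rdecomp R e d * a z d) ^+ 2)).
by rewrite exchange_big /=; under eq_bigr => z _ do rewrite sum_rdecomp_sqr.
Qed.

Lemma sum_rng_database x (F : rng S * database S -> R) :
  \sum_zD F zD = \sum_(D : database S | D x == None) \sum_z \sum_d F (z, upd D x d).
Proof.
rewrite (eq_bigr (fun p => F (p.1, p.2))); last by case.
rewrite -(pair_bigA _ (fun z D => F (z, D))) /=.
under eq_bigr => z _ do rewrite (sum_database x).
by rewrite exchange_big.
Qed.

Lemma rkern_local_upd x (u : rng S * database S -> R) z D d :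
  \sum_zD rkern x zD (z, upd D x d) * u zD
    = local_query (fun z d => u (z, upd D x d)) z d.
Proof.
rewrite rkern_local upd_at /local_query; apply: eq_bigr => e _; congr (_ * _).
by apply: eq_bigr => d' _; rewrite upd_upd.
Qed.

Lemma rkern_norm x (u : rng S * database S -> R) :
  \sum_zD' (\sum_zD rkern x zD zD' * u zD) ^+ 2 = \sum_zD u zD ^+ 2.
Proof.
rewrite !(sum_rng_database x); apply: eq_bigr => D _.
under eq_bigr => z _ do under eq_bigr => d _ do rewrite rkern_local_upd.
exact: local_query_norm.
Qed.

Context (Fresh : freshness S) (c : cut_data S).

(** Fix [D] undefined at [x] and vary the entry there. If [D] hits, so does every extension, and [u]
    vanishes on the fibre. Otherwise a hit needs [x] fresh and one of at most [K] values, each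
    charged [10 / N] by [local_query_hit]. The double negation is the form that a support
    [predC (Hit Fresh c)] takes. *)
Lemma rkern_hit K x (u : rng S * database S -> R) :
  (#|cut_target c| <= K)%N ->
  (forall zD, ~~ ~~ Hit Fresh c zD.2 -> u zD = 0) ->
  \sum_(zD' | Hit Fresh c zD'.2) (\sum_zD rkern x zD zD' * u zD) ^+ 2
    <= 10%:R * K%:R / 2 ^+ secpar S * \sum_zD u zD ^+ 2.
Proof.
move=> CK u0; set N : R := 2 ^+ _.
have Np : 0 < N by rewrite exprn_gt0.
rewrite big_mkcond !(sum_rng_database x) mulr_sumr; apply: ler_sum => D /eqP Dx.
pose a z d := u (z, upd D x d).
pose hitx d := cut_fresh Fresh c x && (if d is Some y then y \in cut_target c else false).
have aq z d : \sum_zD rkern x zD (z, upd D x d) * u zD = local_query a z d.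
  exact: rkern_local_upd.
have hitE d : Hit Fresh c (upd D x d) = Hit Fresh c D || hitx d.
  apply/existsP/orP => [[x']|].
    have [->|ne] := eqVneq x' x; first by rewrite upd_at; right.
    by rewrite upd_other // => H; left; apply/existsP; exists x'.
  case=> [/existsP[x' H]|H]; last by exists x; rewrite upd_at.
  exists x'; rewrite upd_other //; apply: contraL H => /eqP ->.
  by rewrite Dx andbF.
have rhs0 : 0 <= \sum_z \sum_d a z d ^+ 2.
  by apply: sumr_ge0 => z _; apply: sumr_ge0 => d _; apply: sqr_ge0.
have C0 : 0 <= 10 * K%:R / N.
  by rewrite divr_ge0 ?mulr_ge0 ?ler0n // ltW.
under eq_bigr => z _ do under eq_bigr => d _ do rewrite /= aq.
have [hD|hD] := boolP (Hit Fresh c D).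
  rewrite big1; first exact: mulr_ge0.
  move=> z _; apply: big1 => d _; case: ifP => // _.
  rewrite /local_query big1 ?expr0n // => e _; rewrite big1 ?mulr0 // => d' _.
  by rewrite /a u0 ?mulr0 //= negbK hitE hD.
have hitN d : Hit Fresh c (upd D x d) = hitx d by rewrite hitE (negbTE hD).
under eq_bigr => z _ do rewrite -big_mkcond (eq_bigl _ _ hitN) /=.
rewrite exchange_big /=.
apply: (@le_trans _ _ (\sum_(y in cut_target c)
    10 / N * \sum_z \sum_d a z d ^+ 2)); last first.
  rewrite sumr_const -[_ *+ #|_|]mulr_natl mulrA ler_wpM2r //.
  have : #|cut_target c|%:R <= K%:R :> R by rewrite ler_nat.
  by move=> ?; rewrite mulrC [X in _ <= X]mulrAC ler_wpM2l // divr_ge0 // ltW.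
have [fx|fx] := boolP (cut_fresh Fresh c x); last first.
  rewrite big_pred0; last by move=> d; rewrite /hitx (negbTE fx).
  by apply: sumr_ge0 => y _; rewrite mulr_ge0 // divr_ge0 // ltW.
rewrite big_mkcond sum_option /= {1}/hitx andbF add0r [X in _ <= X]big_mkcond.
apply: ler_sum => y _; rewrite /hitx fx /=; case: ifP => // yC.
apply: local_query_hit => z; rewrite /a u0 //= negbK hitE /hitx fx yC.
by rewrite orbT.
Qed.

End Database.

(** * Minkowski's inequality for branch weights *)

Section Minkowski.
Context (R : realType).

(** The triangle inequality in the plane for the vectors with coordinates [Num.sqrt a],
    [Num.sqrt a'] and [t * Num.sqrt b], [t * Num.sqrt b']. *)
Lemma sqrtD_le (t x x' a a' b b' : R) :
  0 <= t -> 0 <= x -> 0 <= x' -> 0 <= a -> 0 <= a' -> 0 <= b -> 0 <= b' ->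
  Num.sqrt x <= Num.sqrt a + t * Num.sqrt b ->
  Num.sqrt x' <= Num.sqrt a' + t * Num.sqrt b' ->
  Num.sqrt (x + x') <= Num.sqrt (a + a') + t * Num.sqrt (b + b').
Proof.
move=> t0 x0 x0' a0 a0' b0 b0' H H'.
have s0 := @sqrtr_ge0 R.
have rhs0 : 0 <= Num.sqrt (a + a') + t * Num.sqrt (b + b').
  by rewrite addr_ge0 ?mulr_ge0.
rewrite -[leRHS]ger0_norm // -sqrtr_sqr ler_sqrt ?sqr_ge0 //.
have E : x + x' <= (Num.sqrt a + t * Num.sqrt b) ^+ 2
                   + (Num.sqrt a' + t * Num.sqrt b') ^+ 2.
  rewrite -{1}[x]sqr_sqrtr // -{1}[x']sqr_sqrtr //.
  by apply: lerD; rewrite ler_pXn2r // nnegrE ?addr_ge0 ?mulr_ge0.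
apply: le_trans E _.
have CS : Num.sqrt a * Num.sqrt b + Num.sqrt a' * Num.sqrt b'
          <= Num.sqrt (a + a') * Num.sqrt (b + b').
  have -> : Num.sqrt (a + a') * Num.sqrt (b + b') = Num.sqrt ((a + a') * (b + b')).
    by rewrite sqrtrM // addr_ge0.
  rewrite -[leLHS]ger0_norm; last by apply: addr_ge0; apply: mulr_ge0.
  rewrite -sqrtr_sqr ler_sqrt; last by apply: mulr_ge0; apply: addr_ge0.
  rewrite -{2}[a]sqr_sqrtr // -{2}[a']sqr_sqrtr // -{2}[b]sqr_sqrtr //.
  rewrite -{2}[b']sqr_sqrtr // -subr_ge0.
  set p := Num.sqrt a; set q := Num.sqrt b; set r := Num.sqrt a'; set s := Num.sqrt b'.
  rewrite (_ : _ - _ = (p * s - q * r) ^+ 2) ?sqr_ge0 //; ring.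
have Ea := sqr_sqrtr (addr_ge0 a0 a0'); have Eb := sqr_sqrtr (addr_ge0 b0 b0').
rewrite !sqrrD !exprMn Ea Eb !sqr_sqrtr //.
have := ler_wpM2l t0 CS.
move: (Num.sqrt a) (Num.sqrt b) (Num.sqrt a') (Num.sqrt b') => p q r s.
move: (Num.sqrt _) (Num.sqrt _) => A B.
rewrite !mulrDr; lra.
Qed.

(** Since [t] is common to all terms, the errors of the branches combine without a factor for their
    number. *)
Lemma sqrt_sum_le (I : Type) (s : seq I) (P : pred I) (t : R) (x a b : I -> R) :
  0 <= t -> (forall i, 0 <= x i) -> (forall i, 0 <= a i) -> (forall i, 0 <= b i) ->
  (forall i, P i -> Num.sqrt (x i) <= Num.sqrt (a i) + t * Num.sqrt (b i)) ->
  Num.sqrt (\sum_(i <- s | P i) x i)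
    <= Num.sqrt (\sum_(i <- s | P i) a i) + t * Num.sqrt (\sum_(i <- s | P i) b i).
Proof.
move=> t0 x0 a0 b0 H; elim: s => [|i s IH].
  by rewrite !big_nil sqrtr0 mulr0 addr0.
rewrite !big_cons; case: ifP => // Pi.
by apply: sqrtD_le => //; try apply: sumr_ge0 => //; apply: H.
Qed.

End Minkowski.

(** * Weights of states under the steps of the adversary and sampling *)

Section States.
Local Open Scope sesquilinear_scope.
Context (R : realType) (S : signature) (O : oracle R S).
Implicit Types (psi : state O) (P : pred (oreg O)).

(** [P] sees only the oracle register, so operations on the adversary's side preserve this weight.
    For [P := Hit Fresh c] it is the squared norm of the hit component. *)
Definition wnorm P psi : R := \sum_(bo | P bo.2) normc (psi bo) ^+ 2.

Lemma wnorm_ge0 P psi : 0 <= wnorm P psi.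
Proof. by apply: sumr_ge0 => bo _; apply: sqr_ge0. Qed.

Lemma sqnormE psi : sqnorm psi = wnorm predT psi.
Proof. by []. Qed.

Lemma sqnorm_ge0 psi : 0 <= sqnorm psi.
Proof. exact: (wnorm_ge0 predT). Qed.

Lemma sqnorm0P psi : reflect (psi = 0) (sqnorm psi == 0).
Proof.
rewrite /sqnorm psumr_eq0 => [|bo _]; last exact: sqr_ge0.
apply: (iffP allP) => [H|-> bo _]; last by rewrite /= ffunE normc0 expr0n.
apply/ffunP => bo; rewrite ffunE; apply: eq0_normc.
have := H bo (mem_index_enum bo); rewrite /= sqrf_eq0; exact/eqP.
Qed.

Lemma wnorm_measure P psi :
  \sum_m wnorm P (op_measure m psi) = wnorm P psi.
Proof.
rewrite exchange_big /=; apply: eq_bigr => bo _.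
rewrite (bigD1 bo.1.1.2) //= ffunE eqxx big1 ?addr0 // => m ne.
by rewrite ffunE eq_sym (negbTE ne) normc0 expr0n.
Qed.

Lemma wnorm_scale P a psi : wnorm P (op_scale a psi) = a ^+ 2 * wnorm P psi.
Proof.
rewrite mulr_sumr; apply: eq_bigr => bo _.
by rewrite ffunE normcM /= expr0n /= addr0 sqrtr_sqr exprMn real_normK ?num_real.
Qed.

Lemma wnorm_sample P n (mu : 'I_n -> R) psi : is_distr mu ->
  \sum_i wnorm P (op_scale (Num.sqrt (mu i)) psi) = wnorm P psi.
Proof.
move=> /andP[/forallP mu0 /eqP mu1].
under eq_bigr => i _ do rewrite wnorm_scale sqr_sqrtr //.
by rewrite -mulr_suml mu1 mul1r.
Qed.

Lemma sqnorm_unitary_mx n (U : 'M[R[i]]_n) (v : 'I_n -> R[i]) :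
  U \is unitarymx ->
  \sum_i normc (\sum_j U i j * v j) ^+ 2 = \sum_j normc (v j) ^+ 2.
Proof.
move=> Uu; apply: (@complexI R).
have normcJ (z : R[i]) : real_complex R (normc z ^+ 2) = z^* * z.
  by rewrite rmorphXn /= mulrC -normCK.
have E w : real_complex R (\sum_i normc (w i) ^+ 2) = \sum_i (w i)^* * w i.
  by rewrite rmorph_sum; apply: eq_bigr => i _; rewrite /= normcJ.
rewrite !E; pose V : 'cV_n := \col_j v j.
have UV i : \sum_j U i j * v j = (U *m V) i 0.
  by rewrite mxE; apply: eq_bigr => j _; rewrite mxE.
have dotE (W : 'cV[R[i]]_n) : \sum_i (W i 0)^* * W i 0 = (W ^t* *m W) 0 0.
  by rewrite mxE; apply: eq_bigr => j _; rewrite !mxE.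
under eq_bigr => i _ do rewrite UV.
rewrite dotE trmx_mul map_mxM /= mulmxA -[_ *m _ *m U]mulmxA.
have -> : U ^t* *m U = 1%:M by apply/mulmx1C/unitarymxP.
by rewrite mulmx1 -dotE; apply: eq_bigr => j _; rewrite mxE.
Qed.

Lemma sum_wnorm P psi :
  wnorm P psi = \sum_(o | P o) \sum_b normc (psi (b, o)) ^+ 2.
Proof.
rewrite exchange_big pair_big_dep /=.
by apply: eq_big => -[b o].
Qed.

Lemma wnorm_unitary P U psi : U \is unitarymx ->
  wnorm P (op_unitary U psi) = wnorm P psi.
Proof.
move=> Uu; rewrite !sum_wnorm; apply: eq_bigr => o _.
have bij := onW_bij _ (@enum_val_bij (basis S)).
rewrite (reindex _ (bij _)) [RHS](reindex _ (bij _)) /=.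
rewrite -(sqnorm_unitary_mx (fun j => psi (enum_val j, o)) Uu).
apply: eq_bigr => i _; rewrite ffunE (reindex _ (bij _)) /=; congr (normc _ ^+ 2).
by apply: eq_bigr => j _; rewrite !enum_valK.
Qed.

End States.

(** Regrouping makes a query block diagonal: [x], [m], [w] are parameters, and the kernel acts on
    output and oracle registers. *)
Lemma sum_query_basis (S : signature) (I : finType) (V : nmodType) (P : pred I)
    (F : basis S * I -> V) :
  \sum_(bo | P bo.2) F bo
  = \sum_(xmw : dom S * cmd S * wsp S) \sum_(zo : rng S * I | P zo.2)
      F ((xmw.1.1, zo.1, xmw.1.2, xmw.2), zo.2).
Proof.
rewrite pair_big_dep /=.
rewrite (reindex (fun p : (dom S * cmd S * wsp S) * (rng S * I) =>
  ((p.1.1.1, p.2.1, p.1.1.2, p.1.2), p.2.2) : basis S * I)) //=.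
exists (fun bo => ((bo.1.1.1.1, bo.1.1.2, bo.1.2), (bo.1.1.1.2, bo.2))) => /=.
  by move=> [[[x m] w] [z o]].
by move=> [[[[x z] m] w] o].
Qed.

(** * Norm and hit amplitude under one query or one evaluation *)

Section CompressedSteps.
Context (R : realType) (S : signature).
Local Notation O := (compressed_oracle R S).
Local Notation cnorm := (@wnorm R S O).
Implicit Types (psi phi : state O).

Section KernelBound.
Context (P supp : pred (database S)) (M : R).
Context (kernel_bound : forall x (u : rng S * database S -> R),
  (forall zD, ~~ supp zD.2 -> u zD = 0) ->
  \sum_(zD' | P zD'.2) (\sum_zD rkern R x zD zD' * u zD) ^+ 2
    <= M * \sum_zD u zD ^+ 2).

(** To be used with [M = 1] and trivial predicates for the total norm, and with
    [M = 10 K / 2^lambda] from databases without a hit to databases with one. *)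
Lemma compressed_kern_bound x (v : rng S * database S -> R[i]) :
  (forall zD, ~~ supp zD.2 -> v zD = 0) ->
  \sum_(zD' | P zD'.2) normc (\sum_zD compressed_kern R x zD zD' * v zD) ^+ 2
    <= M * \sum_zD normc (v zD) ^+ 2.
Proof.
move=> v0.
under eq_bigr => i _ do under eq_bigr => j _ do rewrite compressed_kernE.
exact: (real_kernel_bound (P := fun zD' => P zD'.2)
  (supp := fun zD => supp zD.2) (k := fun i j => rkern R x j i) (kernel_bound x)).
Qed.

Lemma wnorm_query_le psi : (forall bo, ~~ supp bo.2 -> psi bo = 0) ->
  cnorm P (op_query psi) <= M * sqnorm psi.
Proof.
move=> psi0; rewrite /wnorm /sqnorm !sum_query_basis.
rewrite (sum_query_basis predT) mulr_sumr; apply: ler_sum => -[[x m] w] _ /=.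
under eq_bigr => zD' _ do rewrite ffunE /=.
have := @compressed_kern_bound x (fun zD => psi ((x, zD.1, m, w), zD.2))
          (fun zD => psi0 ((x, zD.1, m, w), zD.2)).
by apply: le_trans; rewrite le_eqVlt; apply/orP; left; apply/eqP/eq_bigr => -[].
Qed.

(** An evaluation is a query on a fresh output register: extend [psi] by zero to [z != 0]. Summing
    over the outcomes [y] then sums over the output register. *)
Lemma wnorm_eval_le x psi : (forall bo, ~~ supp bo.2 -> psi bo = 0) ->
  \sum_y cnorm P (op_eval x y psi) <= M * sqnorm psi.
Proof.
move=> psi0.
have -> : \sum_y cnorm P (op_eval x y psi) = \sum_b \sum_(zD' | P zD'.2)
    normc (\sum_zD compressed_kern R x zD zD' *
       (if zD.1 == 0 then psi (b, zD.2) else 0)) ^+ 2.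
  under eq_bigr => y _ do rewrite sum_wnorm.
  rewrite pair_big_dep /= exchange_big /=.
  apply: eq_bigr => b _; apply: eq_bigr => -[y D'] _ /=; rewrite ffunE /=.
  congr (normc _ ^+ 2).
  rewrite [RHS](eq_bigr (fun p => compressed_kern R x (p.1, p.2) (y, D') *
    (if p.1 == 0 then psi (b, p.2) else 0))); last by case.
  rewrite -(pair_bigA _ (fun z D => compressed_kern R x (z, D) (y, D') *
    (if z == 0 then psi (b, D) else 0))) /= (bigD1 0) //= [X in _ + X]big1 ?addr0.
    by rewrite eqxx.
  by move=> z /negbTE ne; apply: big1 => D _; rewrite ne mulr0.
have -> : sqnorm psi = \sum_b \sum_(zD : rng S * database S)
    normc (if zD.1 == 0 then psi (b, zD.2) else 0) ^+ 2.
  rewrite sqnormE sum_wnorm exchange_big; apply: eq_bigr => b _.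
  rewrite [RHS](eq_bigr (fun p => normc (if p.1 == 0 then psi (b, p.2) else 0) ^+ 2));
    last by case.
  rewrite -(pair_bigA _ (fun z D => normc (if z == 0 then psi (b, D) else 0) ^+ 2)) /=.
  rewrite (bigD1 0) //= [X in _ + X]big1 ?addr0; first by rewrite eqxx.
  by move=> z /negbTE ne; apply: big1 => D _; rewrite ne normc0 expr0n.
rewrite mulr_sumr; apply: ler_sum => b _; apply: compressed_kern_bound => zD s0.
by case: eqP => // _; apply: psi0.
Qed.

End KernelBound.

Lemma rkern_norm_le x (u : rng S * database S -> R) :
  (forall zD, ~~ predT zD.2 -> u zD = 0) ->
  \sum_(zD' | predT zD'.2) (\sum_zD rkern R x zD zD' * u zD) ^+ 2
    <= 1 * \sum_zD u zD ^+ 2.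
Proof. by rewrite rkern_norm mul1r. Qed.

Lemma sqnorm_query_le psi : sqnorm (op_query psi) <= sqnorm psi.
Proof.
by rewrite -[leRHS]mul1r; apply: (wnorm_query_le rkern_norm_le).
Qed.

Lemma sqnorm_eval_le x psi : \sum_y sqnorm (op_eval x y psi) <= sqnorm psi.
Proof.
by rewrite -[leRHS]mul1r; apply: (wnorm_eval_le rkern_norm_le).
Qed.

Context (Fresh : freshness S).
Local Notation hit c := (Hit Fresh c).

Definition off_hit c psi : state O := [ffun bD => if hit c bD.2 then 0 else psi bD].

Lemma hit_decomposition c psi : psi = project_hit Fresh c psi + off_hit c psi.
Proof. by apply/ffunP => bD; rewrite !ffunE; case: ifP => _; rewrite ?addr0 ?add0r. Qed.

Lemma sqnorm_project_hit c psi : sqnorm (project_hit Fresh c psi) = cnorm (hit c) psi.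
Proof.
rewrite /wnorm big_mkcond; apply: eq_bigr => bD _; rewrite ffunE.
by case: ifP => _ //; rewrite normc0 expr0n.
Qed.

Lemma sqnorm_off_hit c psi : sqnorm (off_hit c psi) = cnorm (predC (hit c)) psi.
Proof.
rewrite /wnorm big_mkcond; apply: eq_bigr => bD _; rewrite ffunE /=.
by case: ifP => _ //; rewrite normc0 expr0n.
Qed.

Lemma wnorm_le (P : pred (database S)) psi : cnorm P psi <= sqnorm psi.
Proof.
rewrite /wnorm big_mkcond; apply: ler_sum => bD _; case: ifP => // _; exact: sqr_ge0.
Qed.

Lemma sqrt_normcD_le (a b : R[i]) :
  Num.sqrt (normc (a + b) ^+ 2)
    <= Num.sqrt (normc a ^+ 2) + 1 * Num.sqrt (normc b ^+ 2).
Proof.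
have nge0 (z : R[i]) : 0 <= normc z by case: z => p q; apply: sqrtr_ge0.
by rewrite !sqrtr_sqr !ger0_norm // mul1r le_normcD.
Qed.

(** The hit part of [psi] contributes at most its own norm, the rest only its transition amplitude.
    The additive maps [A i] cover queries as well as evaluations, whose outcome joins the index. *)
Lemma hit_growth (I : finType) (P : pred I) (A : I -> state O -> R[i]) (e : R) c psi :
  0 <= e ->
  (forall i phi phi', A i (phi + phi') = A i phi + A i phi') ->
  (forall phi, \sum_(i | P i) normc (A i phi) ^+ 2 <= sqnorm phi) ->
  (forall phi, (forall bD, ~~ ~~ hit c bD.2 -> phi bD = 0) ->
     \sum_(i | P i) normc (A i phi) ^+ 2 <= e * sqnorm phi) ->
  Num.sqrt (\sum_(i | P i) normc (A i psi) ^+ 2)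
    <= Num.sqrt (cnorm (hit c) psi) + Num.sqrt e * Num.sqrt (sqnorm psi).
Proof.
move=> e0 AD A1 Ae; rewrite {1}[psi](hit_decomposition c).
under eq_bigr => i _ do rewrite AD.
have := sqrt_sum_le (index_enum I) (P := P) (x := fun i =>
  normc (A i (project_hit Fresh c psi) + A i (off_hit c psi)) ^+ 2) ler01
  (fun i => sqr_ge0 _) (fun i => sqr_ge0 _) (fun i => sqr_ge0 _)
  (fun i _ => sqrt_normcD_le (A i (project_hit Fresh c psi)) (A i (off_hit c psi))).
move=> /le_trans; apply.
rewrite mul1r lerD //.
  by rewrite ler_sqrt ?wnorm_ge0 // -sqnorm_project_hit.
rewrite -sqrtrM // ler_sqrt ?mulr_ge0 ?sqnorm_ge0 //.
apply: le_trans (Ae _ _) _.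
  by move=> bD; rewrite negbK ffunE => ->.
by rewrite ler_wpM2l // sqnorm_off_hit wnorm_le.
Qed.

Context (K : nat) (c : cut_data S).
Context (CK : (#|cut_target c| <= K)%N).
Local Notation eps := (Num.sqrt (10%:R * K%:R / 2 ^+ secpar S) : R).

Lemma growth_rate_ge0 : 0 <= (10%:R * K%:R / 2 ^+ secpar S : R).
Proof. by rewrite divr_ge0 ?mulr_ge0 ?ler0n ?exprn_ge0. Qed.

Lemma hit_growth_query psi :
  Num.sqrt (cnorm (hit c) (op_query psi))
    <= Num.sqrt (cnorm (hit c) psi) + eps * Num.sqrt (sqnorm psi).
Proof.
apply: (@hit_growth _ (fun bD => hit c bD.2) (fun bD phi => op_query phi bD)).
- exact: growth_rate_ge0.
- move=> [[[[x z] m] w] D] phi phi'; rewrite !ffunE /= -big_split /=.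
  by apply: eq_bigr => zD _; rewrite ffunE mulrDr.
- by move=> phi; apply: le_trans (sqnorm_query_le _); apply: wnorm_le.
- move=> phi phi0; apply: (@wnorm_query_le (hit c) (predC (hit c))) phi0.
  by move=> x u; apply: rkern_hit.
Qed.

Lemma hit_growth_eval x psi :
  Num.sqrt (\sum_y cnorm (hit c) (op_eval x y psi))
    <= Num.sqrt (cnorm (hit c) psi) + eps * Num.sqrt (sqnorm psi).
Proof.
have E phi : \sum_y cnorm (hit c) (op_eval x y phi)
  = \sum_(i : rng S * (basis S * database S) | hit c i.2.2)
      normc (op_eval x i.1 phi i.2) ^+ 2.
  by rewrite pair_big_dep.
rewrite E.
apply: (@hit_growth _ (fun i : rng S * (basis S * database S) => hit c i.2.2)
  (fun i phi => op_eval x i.1 phi i.2)).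
- exact: growth_rate_ge0.
- move=> [y [b D]] phi phi'; rewrite !ffunE /= -big_split /=.
  by apply: eq_bigr => zD _; rewrite ffunE mulrDr.
- move=> phi; rewrite -E; apply: le_trans (sqnorm_eval_le x _).
  by apply: ler_sum => y _; apply: wnorm_le.
- move=> phi phi0; rewrite -E.
  apply: (@wnorm_eval_le (hit c) (predC (hit c))) phi0.
  by move=> x' u; apply: rkern_hit.
Qed.

End CompressedSteps.

(** * Invariants and morphisms of runs *)

Lemma In_flatten_map (I A : Type) (f : I -> seq A) (s : seq I) a :
  List.In a (flatten [seq f i | i <- s]) ->
  exists i, List.In i s /\ List.In a (f i).
Proof.
elim: s => //= i s IH; rewrite /cat => /List.in_app_iff [Ha|/IH[j [js Ha]]].
  by exists i; split => //; left.
by exists j; split => //; right.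
Qed.

Lemma In_map (A B : Type) (f : A -> B) (s : seq A) b :
  List.In b [seq f a | a <- s] <-> exists2 a, List.In a s & b = f a.
Proof.
split=> [|[a + ->]]; elim: s => //= a' s IH.
  by case=> [<-|/IH[a Ha ->]]; [exists a' => //; left|exists a => //; right].
by case=> [->|/IH]; [left|right].
Qed.

Lemma sum_le_In (R : realType) (A : Type) (s : seq A) (F G : A -> R) :
  (forall a, List.In a s -> F a <= G a) ->
  \sum_(a <- s) F a <= \sum_(a <- s) G a.
Proof.
elim: s => [|a s IH] H; first by rewrite !big_nil.
by rewrite !big_cons lerD ?IH // => [|a' H']; apply: H; [left|right].
Qed.

Lemma sum_flatten_map (R : realType) (I : finType) (A : Type) (f : I -> seq A)
    (F : A -> R) :
  \sum_(a <- flatten [seq f i | i <- enum I]) F a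
    = \sum_(i : I) \sum_(a <- f i) F a.
Proof. by rewrite big_flatten big_map big_enum. Qed.

Lemma sum_flatten_seq (R : realType) (B A : Type) (s : seq B) (f : B -> seq A)
    (F : A -> R) :
  \sum_(a <- flatten [seq f i | i <- s]) F a = \sum_(i <- s) \sum_(a <- f i) F a.
Proof. by rewrite big_flatten big_map. Qed.

Section RunInvariant.
Context (R : realType) (S : signature) (O : oracle R S).
Context (rule : cut_rule S) (halt : pred (branch S)).
Context (Inv : branch S -> state O -> Prop).

Record step_invariant (L : ledger S) : Prop := StepInvariant {
  inv_priv : forall s b psi, Inv b psi -> Inv (set_priv s b) psi;
  inv_emit : forall e b psi, Inv b psi -> Inv (emit e b) psi;
  inv_tick : forall b psi, Inv b psi -> Inv (tick L rule b) psi;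
  inv_hide : forall w b psi, Inv b psi -> Inv (set_hid w b) psi;
  inv_scale : forall a b psi, Inv b psi -> Inv b (op_scale a psi);
  inv_eval : forall k x y b psi,
    Inv b psi -> Inv (log_eval k x y b) (op_eval x y psi);
  inv_accept : forall J m b psi, Inv b psi -> Inv (accept J m b) psi;
  inv_unitary : forall U b psi, Inv b psi -> Inv b (op_unitary U psi);
  inv_query : forall b psi, Inv b psi -> Inv (count_eval b) (op_query psi);
  inv_measure : forall m b psi, Inv b psi -> Inv b (op_measure m psi)
}.

Lemma run_env_invariant L p b psi r : step_invariant L -> Inv b psi ->
  List.In r (run_env L rule halt p b psi) -> Inv r.1 r.2.
Proof.
move=> HI; elim: p b psi => [s|e p IH|p IH|w p IH|n mu Hmu p IH|k x p IH|J m] b psi Hb /=;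
  case: (halt b) => /=; try by case=> // <-.
- by case=> // <-; apply: (inv_priv HI).
- by apply: IH; apply: (inv_emit HI).
- by apply: IH; apply: (inv_tick HI).
- by apply: IH; apply: (inv_hide HI).
- move=> H; have [i [_]] := In_flatten_map H; apply: IH; exact: (inv_scale HI).
- move=> H; have [y [_]] := In_flatten_map H; apply: IH; exact: (inv_eval HI).
- by case=> // <-; apply: (inv_accept HI).
Qed.

Lemma run_adv_invariant E a b psi r : step_invariant (machine E) -> Inv b psi ->
  List.In r (run_adv E rule halt a b psi) -> Inv r.1 r.2.
Proof.
move=> HI; elim: a b psi => [|U HU a IH|a IH|f IH] b psi Hb /=;
  case: (halt b) => /=; try by case=> // <-.
- by apply: IH; apply: (inv_unitary HI).
- by apply: IH; apply: (inv_query HI).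
- move=> H; have [m [_ {}H]] := In_flatten_map H.
  have [r' [H']] := In_flatten_map H.
  by apply: IH; apply: (run_env_invariant HI) H'; apply: (inv_measure HI).
Qed.

End RunInvariant.

Section RunMorphism.
Context (R : realType) (S : signature) (O1 O2 : oracle R S).
Context (t : oreg O2 -> oreg O1 -> R[i]).
Context (t_init : forall o2, \sum_o1 t o2 o1 * oinit o1 = oinit o2).
Context (t_kern : forall x z z' o1 o2',
  \sum_o2 okern x (z, o2) (z', o2') * t o2 o1
    = \sum_o1' t o2' o1' * okern x (z, o1) (z', o1')).

(** A linear map on the oracle register alone, hence commuting with every step of the adversary. By
    [t_kern] it also intertwines the two oracles. *)
Definition transfer (psi : state O1) : state O2 :=
  [ffun bo => \sum_o1 t bo.2 o1 * psi (bo.1, o1)].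

Lemma transfer_init a : transfer (op_init O1 a) = op_init O2 a.
Proof.
apply/ffunP => -[b o]; rewrite !ffunE /= -t_init mulr_sumr.
by apply: eq_bigr => o1 _; rewrite ffunE /= mulrCA.
Qed.

Lemma transfer_unitary U psi : op_unitary U (transfer psi) = transfer (op_unitary U psi).
Proof.
apply/ffunP => -[b o]; rewrite !ffunE /=.
under eq_bigr => c _ do rewrite ffunE mulr_sumr.
rewrite exchange_big; apply: eq_bigr => o1 _; rewrite ffunE mulr_sumr.
by apply: eq_bigr => c _; rewrite mulrCA.
Qed.

Lemma transfer_measure m psi : op_measure m (transfer psi) = transfer (op_measure m psi).
Proof.
apply/ffunP => -[b o]; rewrite !ffunE /=; case: ifP => H.
  by apply: eq_bigr => o1 _; rewrite ffunE /= H.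
by rewrite big1 // => o1 _; rewrite ffunE /= H mulr0.
Qed.

Lemma transfer_scale a psi : op_scale a (transfer psi) = transfer (op_scale a psi).
Proof.
apply/ffunP => -[b o]; rewrite !ffunE /= mulr_sumr.
by apply: eq_bigr => o1 _; rewrite ffunE mulrCA.
Qed.

Lemma transfer_kern x z z' o2' (f : oreg O1 -> R[i]) :
  \sum_o2 okern x (z, o2) (z', o2') * \sum_o1 t o2 o1 * f o1
    = \sum_o1' t o2' o1' * \sum_o1 okern x (z, o1) (z', o1') * f o1.
Proof.
under eq_bigr => o2 _ do rewrite mulr_sumr.
under [RHS]eq_bigr => o1' _ do rewrite mulr_sumr.
rewrite exchange_big [RHS]exchange_big; apply: eq_bigr => o1 _ /=.
under eq_bigr => o2 _ do rewrite mulrA.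
under [RHS]eq_bigr => o2 _ do rewrite mulrA.
by rewrite -!mulr_suml t_kern.
Qed.

Lemma transfer_eval x y psi : op_eval x y (transfer psi) = transfer (op_eval x y psi).
Proof.
apply/ffunP => -[b o]; rewrite !ffunE /=.
under eq_bigr => o2 _ do rewrite ffunE /=.
rewrite (transfer_kern x 0 y o (fun o1 => psi (b, o1))).
by apply: eq_bigr => o1 _; rewrite ffunE.
Qed.

Lemma transfer_query psi : op_query (transfer psi) = transfer (op_query psi).
Proof.
apply/ffunP => -[[[[x z'] m] w] o]; rewrite !ffunE /=.
rewrite (eq_bigr (fun p => okern x (p.1, p.2) (z', o) *
  transfer psi ((x, p.1, m, w), p.2))); last by case.
rewrite -(pair_bigA _ (fun z o2 => okern x (z, o2) (z', o) *
  transfer psi ((x, z, m, w), o2))) /=.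
under eq_bigr => z _ do under eq_bigr => o2 _ do rewrite ffunE /=.
under eq_bigr => z _ do
  rewrite (transfer_kern x z z' o (fun o1 => psi ((x, z, m, w), o1))).
rewrite exchange_big; apply: eq_bigr => o1 _ /=; rewrite ffunE /= -mulr_sumr.
congr (_ * _); rewrite [RHS](eq_bigr (fun p => okern x (p.1, p.2) (z', o1) *
  psi ((x, p.1, m, w), p.2))); last by case.
by rewrite -(pair_bigA _ (fun z o2 => okern x (z, o2) (z', o1) *
  psi ((x, z, m, w), o2))).
Qed.

Let lift (r : branch S * state O1) := (r.1, transfer r.2).

Lemma run_env_transfer L rule halt p b psi :
  run_env L rule halt p b (transfer psi)
    = [seq lift r | r <- run_env L rule halt p b psi].
Proof.
elim: p b psi => [s|e p IH|p IH|w p IH|n mu Hmu p IH|k x p IH|J m] b psi /=;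
  case: (halt b) => //.
- rewrite map_flatten -map_comp; congr flatten; apply: eq_map => i /=.
  by rewrite transfer_scale IH.
- rewrite map_flatten -map_comp; congr flatten; apply: eq_map => y /=.
  by rewrite transfer_eval IH.
Qed.

Lemma run_adv_transfer E rule halt a b psi :
  run_adv E rule halt a b (transfer psi)
    = [seq lift r | r <- run_adv E rule halt a b psi].
Proof.
elim: a b psi => [|U HU a IH|a IH|f IH] b psi /=; case: (halt b) => //.
- by rewrite transfer_unitary IH.
- by rewrite transfer_query IH.
- rewrite map_flatten -map_comp; congr flatten; apply: eq_map => m /=.
  rewrite transfer_measure run_env_transfer map_flatten -!map_comp.
  by congr flatten; apply: eq_map => r /=; rewrite IH.
Qed.

(** Control flow depends on classical data only, and branches with zero vector are kept, so the two
    lists match position by position. *)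
Lemma run_transfer E rule halt :
  run O2 E rule halt = [seq lift r | r <- run O1 E rule halt].
Proof. by rewrite /run -transfer_init run_adv_transfer. Qed.

End RunMorphism.

(** * Growth of the hit amplitude along a run *)

Lemma sum0_In (R : realType) (A : Type) (s : seq A) (F : A -> R) :
  (forall a, List.In a s -> F a = 0) -> \sum_(a <- s) F a = 0.
Proof.
elim: s => [|a s IH] H; first by rewrite big_nil.
by rewrite big_cons H ?IH ?addr0 // => [a' H'|]; [apply: H; right|left].
Qed.

Section Growth.
Context (R : realType) (S : signature) (rule : cut_rule S).
Context (Fresh : freshness S) (K Q : nat).
Local Notation O := (compressed_oracle R S).
Local Notation eps := (Num.sqrt (10%:R * K%:R / 2 ^+ secpar S) : R).
Implicit Types (b : branch S) (psi : state O) (r : branch S * state O).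

(* A branch which is not [good] can no longer become good, and by hypothesis its
   final vectors vanish; the truncated subtraction in [budget] is exact on good
   branches. *)
Definition good b : bool :=
  (evals_after_cut b <= Q)%N &&
  (if cut b is Some c then #|cut_target c| <= K else true)%N.

Definition hit_weight r : R :=
  if cut r.1 is Some c then @wnorm R S O (Hit Fresh c) r.2 else 0.

(** The filter [good] gives the induction the bounds on budget and target size, which are assumed
    only for branches of non-zero probability. *)
Definition win_weight r : R :=
  if isSome (accepted r.1) && good r.1 then hit_weight r else 0.

Definition budget b : R := (Q - evals_after_cut b)%:R * eps.

Lemma hit_weight_ge0 r : 0 <= hit_weight r.
Proof. by rewrite /hit_weight; case: cut => // c; apply: wnorm_ge0. Qed.

Lemma win_weight_ge0 r : 0 <= win_weight r.
Proof. by rewrite /win_weight; case: ifP => // _; apply: hit_weight_ge0. Qed.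

Lemma budget_ge0 b : 0 <= budget b.
Proof. by rewrite mulr_ge0 ?ler0n ?sqrtr_ge0. Qed.

Lemma win_weight_le r : win_weight r <= hit_weight r.
Proof. by rewrite /win_weight; case: ifP => // _; apply: hit_weight_ge0. Qed.

(** The evaluation counter never decreases, and a recorded cut is never replaced. *)
Lemma bad_invariant L : @step_invariant R S O rule (fun b _ => ~~ good b) L.
Proof.
have badc b : ~~ good b -> ~~ good (count_eval b).
  rewrite /good /= !negb_and => /orP[H|->]; last by rewrite orbT.
  rewrite -ltnNge; apply/orP; left; rewrite -ltnNge in H.
  exact: leq_trans (leq_addl _ _).
split=> //.
- move=> b _; rewrite /good /= /take_cut !negb_and => /orP[->//|].
  by case: (cut b) => // c ->; rewrite orbT.
- by move=> k x y b _ /badc; rewrite /log_eval; case: ifP.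
- by move=> b _ /badc.
Qed.

(** * One interface call followed by an arbitrary continuation *)

Section Environment.
Context (L : ledger S) (kA kC : branch S * state O -> R).
Context (kA_ge0 : forall r, 0 <= kA r) (kC_ge0 : forall r, 0 <= kC r).
Context (kA_le : forall r, Num.sqrt (kA r)
  <= Num.sqrt (kC r) + budget r.1 * Num.sqrt (sqnorm r.2)).
Context (kC_at_cut : forall r, at_cut r.1 -> kC r = hit_weight r).
Context (kA_bad : forall r, ~~ good r.1 -> kA r = 0).

Local Notation A p b psi := (\sum_(r <- run_env L rule (@at_acceptance S) p b psi) kA r).
Local Notation C p b psi := (\sum_(r <- run_env L rule (@at_cut S) p b psi) kC r).

Lemma env_win_ge0 p b psi : 0 <= A p b psi.
Proof. exact: sumr_ge0. Qed.

Lemma env_hit_ge0 p b psi : 0 <= C p b psi.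
Proof. exact: sumr_ge0. Qed.

Lemma env_win_bad p b psi : ~~ good b -> A p b psi = 0.
Proof.
move=> bad; apply: sum0_In => r /(run_env_invariant (bad_invariant L)) H.
exact: kA_bad (H bad).
Qed.

Lemma env_hit_at_cut p b psi : at_cut b -> C p b psi = hit_weight (b, psi).
Proof. by move=> H; case: p => *; rewrite /= H big_seq1 kC_at_cut. Qed.

Lemma at_cut_cut b b' :
  cut b' = cut b -> accepted b' = accepted b -> at_cut b' = at_cut b.
Proof. by rewrite /at_cut => -> ->. Qed.

Lemma log_evalE k x y b : (evals_after_cut (log_eval k x y b)
  = isSome (cut b) + evals_after_cut b)%N * (cut (log_eval k x y b) = cut b)
  * (accepted (log_eval k x y b) = accepted b).
Proof. by rewrite /log_eval; case: ifP. Qed.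

(** Before the cut the run to the cut performs the evaluation too, and nothing is charged. After it
    that run has halted, and one increment [eps] is due. *)
Lemma env_hit_eval p k x b psi : ~~ at_acceptance b -> good (count_eval b) ->
  Num.sqrt (\sum_y C (p y) (log_eval k x y b) (op_eval x y psi))
  <= Num.sqrt (C (EEval k x p) b psi)
     + (isSome (cut b))%:R * eps * Num.sqrt (sqnorm psi).
Proof.
rewrite /at_acceptance => nacc g.
have [Hc|Hc] := boolP (at_cut b); last first.
  have -> : isSome (cut b) = false.
    by apply/negbTE; apply: contra Hc => H; rewrite /at_cut H orbT.
  by rewrite /= (negbTE Hc) sum_flatten_map mul0r mul0r addr0.
rewrite env_hit_at_cut //.
under eq_bigr => y _ do rewrite env_hit_at_cut ?(@at_cut_cut b) ?log_evalE //.
move: Hc g; rewrite /at_cut (negbTE nacc) /good /hit_weight /=.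
case cb: (cut b) => [c|] //= _ /andP[_ cK].
under eq_bigr => y _ do rewrite log_evalE cb.
by rewrite mul1r hit_growth_eval.
Qed.

(** For purely classical steps: a branch already at the cut keeps its cut and its vector, so halting
    before or after the step gives the same hit weight. *)
Lemma env_hit_step p b b' psi :
  (at_cut b -> at_cut b' /\ cut b' = cut b) ->
  \sum_(r <- if at_cut b then [:: (b, psi)]
             else run_env L rule (@at_cut S) p b' psi) kC r = C p b' psi.
Proof.
case: ifP => // Hb /(_ isT)[Hb' E].
by rewrite big_seq1 kC_at_cut // env_hit_at_cut // /hit_weight /= E.
Qed.

Lemma at_acceptance_cut b : at_acceptance b -> at_cut b.
Proof. by rewrite /at_cut /at_acceptance => ->. Qed.

Lemma env_growth_halted p b psi : at_acceptance b ->
  Num.sqrt (A p b psi)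
    <= Num.sqrt (C p b psi) + budget b * Num.sqrt (sqnorm psi).
Proof.
move=> acc; have cc := at_acceptance_cut acc.
have -> : A p b psi = kA (b, psi) by case: p => *; rewrite /= acc big_seq1.
by rewrite env_hit_at_cut // -kC_at_cut //; apply: kA_le.
Qed.

Lemma budget_eval k x y b : good (count_eval b) ->
  budget b = (isSome (cut b))%:R * eps + budget (log_eval k x y b).
Proof.
rewrite /budget log_evalE -mulrDl -natrD => /andP[/= H _].
by rewrite addnBA // subnDl.
Qed.

(** Induction on the program of one call. The rest of the run is abstracted into the weights [kA]
    (up to acceptance) and [kC] (up to the cut), for which the bound is assumed as [kA_le]. *)
Lemma env_growth p b psi :
  Num.sqrt (A p b psi)
    <= Num.sqrt (C p b psi) + budget b * Num.sqrt (sqnorm psi).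
Proof.
elim: p b psi => [s|e p IH|p IH|w p IH|n mu Hmu p IH|k x p IH|J m] b psi;
  have [/env_growth_halted//|nacc] := boolP (at_acceptance b);
  rewrite [X in Num.sqrt X <= _]/= (negbTE nacc).
- have -> : C (ERet R s) b psi = kC (set_priv s b, psi).
    rewrite /=; case: ifP => H; rewrite big_seq1 //.
    by rewrite !kC_at_cut.
  by rewrite big_seq1; apply: kA_le.
- by rewrite [run_env _ _ (@at_cut S) _ _ _]/= env_hit_step //; apply: IH.
- rewrite [run_env _ _ (@at_cut S) _ _ _]/= env_hit_step; first exact: IH.
  (* A tick can create a cut, but an existing one is retained by [take_cut]. *)
  move: nacc; rewrite /at_acceptance /at_cut /= /take_cut => /negbTE -> /=.
  by case: (cut b).
- by rewrite [run_env _ _ (@at_cut S) _ _ _]/= env_hit_step //; apply: IH.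
- rewrite sum_flatten_map.
  (* If the run to the cut has already halted, its weight is still spread over the outcomes, so that
     both sides can be compared outcome by outcome. *)
  have -> : C (ESample Hmu p) b psi
            = \sum_i C (p i) b (op_scale (Num.sqrt (mu i)) psi).
    rewrite /=; case: ifP => Hc; last by rewrite sum_flatten_map.
    rewrite big_seq1; under [RHS]eq_bigr => i _ do rewrite env_hit_at_cut //.
    rewrite kC_at_cut // /hit_weight /=; case: (cut b) => [c|].
      by rewrite wnorm_sample.
    by rewrite big1.
  rewrite sqnormE -(wnorm_sample _ _ Hmu).
  apply: sqrt_sum_le; first exact: budget_ge0.
  + by move=> i; apply: env_win_ge0.
  + by move=> i; apply: env_hit_ge0.
  + by move=> i; apply: wnorm_ge0.
  + by move=> i _; apply: IH.
(* If the evaluation leads to bad branches, they stay bad and their win weight is zero. *)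
- rewrite sum_flatten_map; have [g|bad] := boolP (good (count_eval b)); last first.
    rewrite big1 ?sqrtr0 ?addr_ge0 ?mulr_ge0 ?budget_ge0 ?sqrtr_ge0 // => y _.
    apply: env_win_bad; apply: contra bad; rewrite /good !log_evalE; exact: id.
  (* The remaining budget is the same for all outcomes; [0] stands for any of them. *)
  have le1 : Num.sqrt (\sum_y A (p y) (log_eval k x y b) (op_eval x y psi))
    <= Num.sqrt (\sum_y C (p y) (log_eval k x y b) (op_eval x y psi))
       + budget (log_eval k x 0 b) * Num.sqrt (\sum_y sqnorm (op_eval x y psi)).
    apply: sqrt_sum_le; first exact: budget_ge0.
    + by move=> y; apply: env_win_ge0.
    + by move=> y; apply: env_hit_ge0.
    + by move=> y; apply: sqnorm_ge0.
    + move=> y _; apply: le_trans (IH _ _ _) _.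
      by rewrite /budget !log_evalE.
  apply: le_trans le1 _.
  rewrite (budget_eval k x 0 g) mulrDl addrA lerD ?env_hit_eval //.
  rewrite ler_wpM2l ?budget_ge0 // ler_sqrt ?sqnorm_ge0 //.
  exact: sqnorm_eval_le.
- have -> : C (EAccept R S J m) b psi = kC (accept J m b, psi).
    rewrite /=; case: ifP => H; rewrite big_seq1 //.
    by rewrite !kC_at_cut // /at_cut.
  by rewrite big_seq1; apply: kA_le.
Qed.

End Environment.

Section Adversary.
Context (E : execution R S).

Local Notation A a b psi := (\sum_(r <- run_adv E rule (@at_acceptance S) a b psi) win_weight r).
Local Notation C a b psi := (\sum_(r <- run_adv E rule (@at_cut S) a b psi) hit_weight r).

Lemma adv_hit_at_cut a b psi : at_cut b -> C a b psi = hit_weight (b, psi).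
Proof. by move=> H; case: a => *; rewrite /= H big_seq1. Qed.

Lemma adv_win_bad a b psi : ~~ good b -> A a b psi = 0.
Proof.
move=> bad; apply: sum0_In => r /(run_adv_invariant (bad_invariant _)) H.
by rewrite /win_weight (negbTE (H bad)) andbF.
Qed.

Lemma adv_growth_halt b psi :
  Num.sqrt (win_weight (b, psi))
    <= Num.sqrt (hit_weight (b, psi)) + budget b * Num.sqrt (sqnorm psi).
Proof.
rewrite -[leLHS]addr0 lerD ?mulr_ge0 ?budget_ge0 ?sqrtr_ge0 //.
by rewrite ler_sqrt ?hit_weight_ge0 // win_weight_le.
Qed.

(** Both runs follow the same tree until the run for [C] stops at the cut. [budget b] acts as a
    potential: each evaluation after the cut pays one [eps] from it, the other steps pay nothing,
    and the total norm never grows. *)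
Lemma adv_growth a b psi :
  Num.sqrt (A a b psi)
    <= Num.sqrt (C a b psi) + budget b * Num.sqrt (sqnorm psi).
Proof.
have gA a' b' psi' : 0 <= A a' b' psi' by apply: sumr_ge0 => r _; apply: win_weight_ge0.
have gC a' b' psi' : 0 <= C a' b' psi' by apply: sumr_ge0 => r _; apply: hit_weight_ge0.
elim: a b psi => [|U HU a IH|a IH|f IH] b psi;
  (have [acc|nacc] := boolP (at_acceptance b);
    [rewrite (adv_hit_at_cut _ _ (at_acceptance_cut acc)) /= acc big_seq1;
     exact: adv_growth_halt|]);
  rewrite [X in Num.sqrt X <= _]/= (negbTE nacc).
- by rewrite /=; case: ifP => _; rewrite !big_seq1; exact: adv_growth_halt.
- have -> : C (AUnitary HU a) b psi = C a b (op_unitary U psi).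
    rewrite /=; case: ifP => // Hc; rewrite big_seq1 adv_hit_at_cut // /hit_weight /=.
    by case: (cut b) => // c; rewrite wnorm_unitary.
  by rewrite sqnormE -(wnorm_unitary predT psi HU); apply: IH.
- have [g|bad] := boolP (good (count_eval b)); last first.
    by rewrite adv_win_bad // sqrtr0 addr_ge0 ?mulr_ge0 ?budget_ge0 ?sqrtr_ge0.
  apply: le_trans (IH _ _) _.
  have -> : budget b = (isSome (cut b))%:R * eps + budget (count_eval b).
    rewrite /budget -mulrDl -natrD /=; move/andP: g => [/= H _].
    by rewrite addnBA // subnDl.
  rewrite mulrDl addrA lerD //; last first.
    rewrite ler_wpM2l ?budget_ge0 // ler_sqrt ?sqnorm_ge0 //; exact: sqnorm_query_le.
  rewrite [run_adv _ _ (@at_cut S) (AQuery a) _ _]/=; case: ifP => Hc; last first.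
    have -> : isSome (cut b) = false.
      by apply/negbTE; apply: contraFN Hc => H; rewrite /at_cut H orbT.
    by rewrite mul0r mul0r addr0.
  rewrite big_seq1 adv_hit_at_cut //; move: nacc Hc g.
  rewrite /at_cut /at_acceptance /good /hit_weight /= => /negbTE ->.
  by case: (cut b) => //= c _ /andP[_ cK]; rewrite mul1r hit_growth_query.
- rewrite sum_flatten_map; under eq_bigr => m _ do rewrite sum_flatten_seq.
  (* The continuation of the call is the adversary's next program, chosen by the events just
     published; its induction hypothesis is [kA_le]. *)
  pose kA r := A (f (drop (size (pub b)) (pub r.1))) r.1 r.2.
  pose kC r := C (f (drop (size (pub b)) (pub r.1))) r.1 r.2.
  have H := @env_growth (machine E) kA kC
    (fun r => gA _ _ _) (fun r => gC _ _ _) (fun r => IH _ r.1 r.2)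
    (fun r => @adv_hit_at_cut _ r.1 r.2) (fun r => @adv_win_bad _ r.1 r.2).
  have -> : C (ACall f) b psi = \sum_m
      \sum_(r <- run_env (machine E) rule (@at_cut S)
          (env (ledger_at (machine E) (pub b)) (priv b) m) b (op_measure m psi))
        kC r.
    rewrite /=; case: ifP => Hc; last first.
      by rewrite sum_flatten_map; apply: eq_bigr => m _; rewrite sum_flatten_seq.
    rewrite big_seq1.
    transitivity (\sum_m hit_weight (b, op_measure m psi)).
      rewrite /hit_weight /=; case: (cut b) => [c|]; first by rewrite wnorm_measure.
      by rewrite big1.
    apply: eq_bigr => m _.
    rewrite (@env_hit_at_cut (machine E) kC) // => r Hr; exact: adv_hit_at_cut.
  rewrite sqnormE -wnorm_measure.
  apply: sqrt_sum_le; first exact: budget_ge0.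
  + by move=> m; apply: sumr_ge0 => r _; apply: gA.
  + by move=> m; apply: sumr_ge0 => r _; apply: gC.
  + by move=> m; apply: wnorm_ge0.
  + by move=> m _; apply: H.
Qed.

End Adversary.
End Growth.

(** * From the uniform to the compressed oracle *)

Section TotalNorm.
Context (R : realType) (S : signature) (rule : cut_rule S) (halt : pred (branch S)).
Local Notation O := (compressed_oracle R S).
Implicit Types (psi : state O).

Lemma run_env_norm_le L p b psi :
  \sum_(r <- run_env L rule halt p b psi) sqnorm r.2 <= sqnorm psi.
Proof.
elim: p b psi => [s|e p IH|p IH|w p IH|n mu Hmu p IH|k x p IH|J m] b psi /=;
  case: (halt b); rewrite ?big_seq1 ?sum_flatten_map //.
- rewrite [leRHS](_ : _ = \sum_i sqnorm (op_scale (Num.sqrt (mu i)) psi)).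
    exact: ler_sum.
  by rewrite sqnormE -(wnorm_sample _ _ Hmu).
- by apply: le_trans (sqnorm_eval_le x psi); apply: ler_sum.
Qed.

Lemma run_adv_norm_le E a b psi :
  \sum_(r <- run_adv E rule halt a b psi) sqnorm r.2 <= sqnorm psi.
Proof.
elim: a b psi => [|U HU a IH|a IH|f IH] b psi /=;
  case: (halt b); rewrite ?big_seq1 ?sum_flatten_map //.
- by rewrite [leRHS]sqnormE -(wnorm_unitary predT psi HU); apply: IH.
- by apply: le_trans (IH _ _) _; apply: sqnorm_query_le.
- rewrite [leRHS]sqnormE -wnorm_measure; apply: ler_sum => m _.
  rewrite sum_flatten_seq; apply: le_trans (run_env_norm_le _ _ _ _).
  by apply: ler_sum => r _; apply: IH.
Qed.

Lemma sqnorm_init E : sqnorm (op_init O (@amp0 R S E)) = 1.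
Proof.
rewrite sqnormE sum_wnorm (bigD1 [ffun=> None]) //= [X in _ + X]big1 ?addr0.
  rewrite -[RHS](amp0_unit E); apply: eq_bigr => b _.
  by rewrite ffunE /= eqxx mulr1.
move=> D /negbTE ne; apply: big1 => b _.
by rewrite ffunE /= ne mulr0 normc0 expr0n.
Qed.

Lemma run_norm_le E : \sum_(r <- run O E rule halt) sqnorm r.2 <= 1.
Proof. by rewrite -(sqnorm_init E); apply: run_adv_norm_le. Qed.

End TotalNorm.

(** * The purified uniform oracle and its compression *)

Section Purified.
Context (R : realType) (S : signature).
Local Notation N := (2 ^+ secpar S : R).
Local Notation func := {ffun dom S -> rng S}.
Implicit Types (D : database S) (G H : func).

(** Every function has initial amplitude 1, so that the component at [H] is exactly the run with
    [H]. The normalization is carried by the factors [s] of [compression]. *)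
Definition purified_oracle : oracle R S :=
  @Oracle R S func (fun=> 1)
    (fun x zo zo' => ((zo'.2 == zo.2) && (zo'.1 == zo.1 + zo.2 x))%:R).
Local Notation O := purified_oracle.

Definition restriction H (o : unit) G : R[i] := (G == H)%:R.

Lemma restriction_init H (o : oreg (real_oracle R H)) :
  \sum_(G : oreg O) restriction H o G * oinit G = oinit o.
Proof. by rewrite /restriction sum_delta. Qed.

Lemma restriction_kern H x (z z' : rng S) (G : oreg O) (o' : oreg (real_oracle R H)) :
  \sum_o okern x (z, o) (z', o') * restriction H o G
    = \sum_G' restriction H o' G' * okern x (z, G) (z', G').
Proof.
rewrite /restriction sum_delta /= (bigD1 tt) //= big1 ?addr0; last by case.
rewrite [G == H]eq_sym; case: (H =P G) => [->|_]; first by rewrite mulr1.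
by rewrite mulr0.
Qed.

Local Notation s := ((Num.sqrt N)^-1).

(* Matrix of the compression, applied to the uniform superposition of functions. *)
Definition compression D G : R := \prod_x (s * rdecomp R (D x) (Some (G x))).

Definition compression_off x D G : R :=
  \prod_(x' | x' != x) (s * rdecomp R (D x') (Some (G x'))).

Lemma compression_upd D x d G :
  compression (upd D x d) G
    = rdecomp R d (Some (G x)) * (s * compression_off x D G).
Proof.
rewrite /compression (bigD1 x) //= upd_at.
rewrite (eq_bigr (fun x' => s * rdecomp R (D x') (Some (G x')))) => [|x' ne].
  by rewrite -/(compression_off x D G) mulrCA mulrA.
by rewrite upd_other.
Qed.

(** The sum factors over coordinates. Each factor is the entry at [D x], [None] of the square of
    [rdecomp]: the uniform superposition compresses to the empty entry. *)
Lemma compression_init D :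
  \sum_G compression D G = (D == [ffun=> None])%:R.
Proof.
rewrite -(bigA_distr_bigA (fun x y => s * rdecomp R (D x) (Some y))) /=.
transitivity (\prod_x (D x == None)%:R : R).
  apply: eq_bigr => x _; rewrite -rdecomp_invol sum_option /= mulr0 add0r.
  by apply: eq_bigr => y _; rewrite mulrC.
have [->|ne] := eqVneq D [ffun=> None].
  by rewrite big1 // => x _; rewrite ffunE eqxx.
have /existsP[x Dx] : [exists x, D x != None].
  apply: contraR ne; rewrite negb_exists => /forallP H; apply/eqP/ffunP => x.
  by have := H x; rewrite negbK ffunE => /eqP.
by rewrite (bigD1 x) //= (negbTE Dx) mul0r.
Qed.

(** The decompression inside the query undoes the compression at [x] and exposes the value [G x],
    which shifts [z]; the outer factor compresses again. *)
Lemma compression_kern x z z' G D' :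
  \sum_D rkern R x (z, D) (z', D') * compression D G
    = compression D' G * (z' == z + G x)%:R.
Proof.
transitivity (\sum_zD rkern R x zD (z', D') * ((zD.1 == z)%:R * compression zD.2 G)).
  rewrite [RHS](eq_bigr (fun p => rkern R x (p.1, p.2) (z', D') *
    ((p.1 == z)%:R * compression p.2 G))); last by case.
  rewrite -(pair_bigA _ (fun z1 D => rkern R x (z1, D) (z', D') *
    ((z1 == z)%:R * compression D G))) /= (bigD1 z) //= [X in _ + X]big1 ?addr0.
    by apply: eq_bigr => D _; rewrite eqxx mul1r.
  by move=> z1 /negbTE ne; apply: big1 => D _; rewrite ne mul0r mulr0.
rewrite rkern_local /local_query /=.
transitivity (\sum_e (e == Some (G x))%:R * (rdecomp R (D' x) e *
   ((z' - odflt 0 e == z)%:R * (s * compression_off x D' G)))).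
  apply: eq_bigr => e _; rewrite -rdecomp_invol mulrCA; congr (_ * _).
  rewrite mulr_suml; apply: eq_bigr => d _.
  by rewrite compression_upd; ring.
rewrite sum_delta /= -subr_eq -[in RHS](upd_id D' x) compression_upd.
by ring.
Qed.

(** The columns for [G] and [G'] have as inner product the product over [x] of [N^-1] times the
    indicator of [G x = G' x], so they are orthogonal. *)
Lemma compression_norm (u : func -> R) :
  \sum_D (\sum_G compression D G * u G) ^+ 2 = #|{: func}|%:R^-1 * \sum_G u G ^+ 2.
Proof.
transitivity (\sum_D \sum_G \sum_G' compression D G * compression D G' * (u G * u G')).
  apply: eq_bigr => D _; rewrite expr2 mulr_suml; apply: eq_bigr => G _.
  by rewrite mulr_sumr; apply: eq_bigr => G' _; ring.
rewrite exchange_big mulr_sumr; apply: eq_bigr => G _; rewrite exchange_big /=.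
transitivity (\sum_G' (G' == G)%:R * (#|{: func}|%:R^-1 * (u G * u G'))).
  apply: eq_bigr => G' _; rewrite -mulr_suml [RHS]mulrA; congr (_ * _).
  under eq_bigr => D _ do rewrite -big_split /=.
  rewrite -(bigA_distr_bigA (fun x d => s * rdecomp R d (Some (G x)) *
     (s * rdecomp R d (Some (G' x))))) /=.
  transitivity (\prod_x (N^-1 * (G' x == G x)%:R) : R).
    apply: eq_bigr => x _; rewrite -(inj_eq (@Some_inj _)) -rdecomp_invol mulr_sumr.
    apply: eq_bigr => d _; rewrite [rdecomp R (Some _) d]rdecompC -invsqrt_range_size.
    ring.
  rewrite big_split /= prodr_const exprVn card_ffun natrX card_rng mulrC.
  have [->|ne] := eqVneq G' G; first by rewrite big1 // => x _; rewrite eqxx.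
  have /existsP[x Gx] : [exists x, G' x != G x].
    apply: contraR ne; rewrite negb_exists => /forallP H; apply/eqP/ffunP => x.
    by have := H x; rewrite negbK => /eqP.
  by rewrite (bigD1 x) //= (negbTE Gx) !mul0r.
by rewrite sum_delta expr2.
Qed.

Definition compress (o : database S) G : R[i] := real_complex R (compression o G).

Lemma compress_init (D : oreg (compressed_oracle R S)) :
  \sum_(G : oreg O) compress D G * oinit G = oinit D.
Proof.
under eq_bigr => G _ do rewrite /= mulr1.
by rewrite -rmorph_sum compression_init /= rmorph_nat.
Qed.

Lemma compress_kern x (z z' : rng S) (G : oreg O)
    (D' : oreg (compressed_oracle R S)) :
  \sum_D okern x (z, D) (z', D') * compress D G
    = \sum_G' compress D' G' * okern x (z, G) (z', G').
Proof.
transitivity (real_complex R (\sum_D rkern R x (z, D) (z', D') * compression D G)).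
  by rewrite rmorph_sum; apply: eq_bigr => D _; rewrite /= compressed_kernE rmorphM.
rewrite compression_kern rmorphM /= rmorph_nat.
rewrite (bigD1 G) //= big1 ?addr0 ?eqxx //.
by move=> G' /negbTE ne; rewrite ne mulr0.
Qed.

End Purified.

Section Correspondence.
Context (R : realType) (S : signature).
Local Notation N := (2 ^+ secpar S : R).
Local Notation func := {ffun dom S -> rng S}.
Local Notation OP := (purified_oracle R S).
Local Notation OC := (compressed_oracle R S).
Implicit Types (psi : state OP) (G H : func).

Local Notation compressed := (@transfer R S OP OC (@compress R S)).
Local Notation restrict H := (@transfer R S OP (real_oracle R H) (@restriction R S H)).

Lemma restrictE H psi b : restrict H psi (b, tt) = psi (b, H).
Proof. by rewrite ffunE /restriction /= sum_delta. Qed.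

Lemma sqnorm_restrict H psi : sqnorm (restrict H psi) = \sum_b normc (psi (b, H)) ^+ 2.
Proof.
rewrite sqnormE sum_wnorm (bigD1 tt) //= [X in _ + X]big1 ?addr0; last by case.
by apply: eq_bigr => b _; rewrite restrictE.
Qed.

(** The normalization of the compression becomes the average over a uniform [H]. *)
Lemma sqnorm_compressed psi :
  sqnorm (compressed psi) = #|{: func}|%:R^-1 * \sum_H sqnorm (restrict H psi).
Proof.
under eq_bigr => H _ do rewrite sqnorm_restrict.
rewrite sqnormE sum_wnorm exchange_big [in RHS]exchange_big /= mulr_sumr.
apply: eq_bigr => b _.
under eq_bigr => D _ do rewrite ffunE normc2_real_sum.
rewrite big_split /= !compression_norm -mulrDr -big_split /=.
by congr (_ * _); apply: eq_bigr => H _; rewrite normc2E.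
Qed.

(* The coordinate [x] of the compressed state is the compression of [y], whose
   amplitude on [y] itself is 1 - 1/N. *)
Lemma off_check_le x y psi : (forall b G, G x != y -> psi (b, G) = 0) ->
  @wnorm R S OC (fun D => D x != Some y) (compressed psi)
    <= 2 / N * sqnorm (compressed psi).
Proof.
move=> psi0.
pose g D b : R[i] := \sum_(G : func)
  real_complex R ((Num.sqrt N)^-1 * compression_off R x D G) * psi (b, G).
have gE D d b : normc (compressed psi (b, upd D x d)) ^+ 2
    = rdecomp R d (Some y) ^+ 2 * normc (g D b) ^+ 2.
  have -> : compressed psi (b, upd D x d) = real_complex R (rdecomp R d (Some y)) * g D b.
    rewrite ffunE /= mulr_sumr; apply: eq_bigr => G _.
    have [Gx|Gx] := eqVneq (G x) y; last by rewrite psi0 // !mulr0.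
    by rewrite /compress compression_upd Gx rmorphM mulrA.
  by rewrite normcM exprMn /= expr0n /= addr0 sqrtr_sqr real_normK ?num_real.
have sum1 : \sum_d rdecomp R d (Some y) ^+ 2 = 1.
  under eq_bigr => d _ do rewrite expr2 {1}rdecompC.
  by rewrite rdecomp_invol eqxx.
(* What remains is 1 - (1 - 1/N)^2 = 2/N - 1/N^2. *)
have sum2 : \sum_(d | d != Some y) rdecomp R d (Some y) ^+ 2 <= 2 / N.
  move: sum1; rewrite (bigD1 (Some y)) //= eqxx mulr1n.
  by have := sqr_ge0 (N^-1); move: (N^-1) (bigop _ _ _) => M X; lra.
rewrite sqnormE !sum_wnorm big_mkcond !(sum_database x) mulr_sumr.
apply: ler_sum => D _.
under eq_bigr => d _ do rewrite upd_at.
rewrite -big_mkcond /=.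
under eq_bigr => d _ do (under eq_bigr => b _ do rewrite gE; rewrite -mulr_sumr).
under [X in _ <= _ * X]eq_bigr => d _ do
  (under eq_bigr => b _ do rewrite gE; rewrite -mulr_sumr).
rewrite -!mulr_suml sum1 mul1r ler_wpM2r //.
by apply: sumr_ge0 => b _; apply: sqr_ge0.
Qed.

End Correspondence.

Section Consistency.
Context (R : realType) (S : signature) (H : {ffun dom S -> rng S}).
Local Notation O := (real_oracle R H).

Definition truthful (e : check_entry S) : Prop := ck_value e = H (ck_point e).

(** A run also lists the outcomes [y != H x] of an evaluation, but with zero vector; hence the
    premise. *)
Definition consistent (b : branch S) (psi : state O) : Prop :=
  psi != 0 ->
  (forall e, List.In e (checks b) -> truthful e) /\
  (forall a e, accepted b = Some a -> List.In e (retained a) -> truthful e).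

Lemma In_pmap_onth (A : Type) (s : seq A) J e :
  List.In e (pmap (onth s) J) -> List.In e s.
Proof.
elim: J => //= j J IH; case E: (onth s j) => [e'|] //= [<-|//].
elim: s j E {IH} => [|a s IH] [|j] //=; first by case=> ->; left.
by move/IH; right.
Qed.

Lemma In_rcons (A : Type) (s : seq A) a e :
  List.In e (rcons s a) -> List.In e s \/ e = a.
Proof.
elim: s => [|a' s IH] /=; first by case=> // ->; right.
by case=> [->|/IH[]]; [left; left|left; right|right].
Qed.

Lemma op_eval_real0 x y (psi : state O) : y != H x -> op_eval x y psi = 0.
Proof.
move=> ne; apply/ffunP => bo; rewrite !ffunE big1 // => o _.
by rewrite /= add0r (negbTE ne) mul0r.
Qed.

Lemma consistent_invariant rule L : @step_invariant R S O rule consistent L.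
Proof.
(* A non-zero image under a map fixing 0 has a non-zero preimage, so the premise of [consistent]
   passes backwards. *)
have op0 (f : state O -> state O) b psi : f 0 = 0 ->
    consistent b psi -> consistent b (f psi).
  by move=> f0 c ne; apply: c; apply: contraNneq ne => ->; rewrite f0.
split=> //.
- move=> a b psi; apply: op0.
  by apply/ffunP => bo; rewrite !ffunE mulr0.
- move=> k x y b psi c.
  have [yx|ne] := eqVneq y (H x); last by rewrite /consistent op_eval_real0 ?eqxx.
  have c' : consistent b (op_eval x y psi).
    apply: op0 c; apply/ffunP => bo; rewrite !ffunE big1 // => o _.
    by rewrite ffunE mulr0.
  move=> /c'[cc ca]; rewrite /log_eval; case: ifP => _; split=> //=.
  by move=> e He; have [/cc//|->] := In_rcons He.
- move=> J m b psi c /c[cc _]; split=> //= a e [<-] /=.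
  by move=> He; apply/cc/(In_pmap_onth He).
- move=> U b psi; apply: op0; apply/ffunP => bo; rewrite !ffunE big1 // => i _.
  by rewrite ffunE mulr0.
- move=> b psi; apply: (@op0 (@op_query R S O) (count_eval b)).
  apply/ffunP => -[[[[x z] m] w] o]; rewrite !ffunE /= big1 // => i _.
  by rewrite ffunE mulr0.
- move=> m b psi; apply: op0; apply/ffunP => bo; rewrite !ffunE.
  by case: ifP.
Qed.

Lemma run_consistent E rule halt r :
  List.In r (run O E rule halt) -> consistent r.1 r.2.
Proof. by apply: run_adv_invariant; [exact: consistent_invariant|split]. Qed.

End Consistency.

(** * The bound *)

Section MainBound.
Context (R : realType) (S : signature) (E : execution R S) (rule : cut_rule S).
Context (Fresh : freshness S) (K Q ell : nat).
Local Notation N := (2 ^+ secpar S : R).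
Local Notation func := {ffun dom S -> rng S}.
Local Notation OP := (purified_oracle R S).
Local Notation OC := (compressed_oracle R S).
Local Notation compressed := (@transfer R S OP OC (@compress R S)).
Local Notation restrict H := (@transfer R S OP (real_oracle R H) (@restriction R S H)).

Lemma run_compressedE halt :
  run OC E rule halt = [seq (r.1, compressed r.2) | r <- run OP E rule halt].
Proof. exact: run_transfer (@compress_init R S) (@compress_kern R S) _ _ _. Qed.

Lemma run_realE H halt :
  run (real_oracle R H) E rule halt
    = [seq (r.1, restrict H r.2) | r <- run OP E rule halt].
Proof. exact: run_transfer (@restriction_init R S H) (@restriction_kern R S H) _ _ _. Qed.

(** All runs share one list of branches, so the average over [H] can be taken inside each branch. *)
Lemma Pr_WE : Pr_W E rule
  = \sum_(r <- run OC E rule (@at_acceptance S) | isSome (accepted r.1)) sqnorm r.2.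
Proof.
rewrite /Pr_W run_compressedE big_map /=.
under [RHS]eq_bigr => r _ do rewrite sqnorm_compressed.
rewrite -mulr_sumr exchange_big /=; congr (_ * _); apply: eq_bigr => H _.
by rewrite run_realE big_map.
Qed.

Lemma beta_cutE : beta_cut E rule Fresh
  = Num.sqrt (\sum_(r <- run OC E rule (@at_cut S)) hit_weight Fresh r).
Proof.
congr Num.sqrt; apply: eq_bigr => r _; rewrite /hit_weight.
by case: (cut r.1) => // c; exact: sqnorm_project_hit.
Qed.

(** A single non-zero amplitude at [H] opens the branch to the hypotheses, which are stated for runs
    with that [H]. *)
Lemma possible_restrict H b (psi : state OP) x :
  List.In (b, psi) (run OP E rule (@at_acceptance S)) -> psi (x, H) != 0 ->
  possible E rule H b /\ consistent b (restrict H psi) /\ restrict H psi != 0.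
Proof.
move=> Hin nz; have nz' : restrict H psi != 0.
  by apply: contraNneq nz => /ffunP/(_ (x, tt)); rewrite restrictE ffunE => ->.
have Hr : List.In (b, restrict H psi) (run (real_oracle R H) E rule (@at_acceptance S)).
  by rewrite run_realE; apply/In_map; exists (b, psi).
split; first by exists (restrict H psi) => //; apply: contraNN nz' => /sqnorm0P ->.
by split=> //; apply: (run_consistent Hr).
Qed.

Context (bounded : cut_bounded E rule K) (needs_cut : W_needs_cut E rule).
Context (fresh_hit : W_has_fresh_hit E rule Fresh ell).
Context (budgeted : post_cut_budget E rule Q).

(** One function [H] in the support provides a fresh retained check with value in [C]. That check
    belongs to the branch, so consistency forces the same value on every other function in the
    support, and [off_check_le] applies. *)
Lemma accepted_branch_le b (psi : state OP) :
  List.In (b, psi) (run OP E rule (@at_acceptance S)) -> isSome (accepted b) ->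
  sqnorm (compressed psi) <= win_weight Fresh K Q (b, compressed psi)
     + 2 * ell%:R / N * sqnorm (compressed psi).
Proof.
move=> Hin acc.
have N0 : 0 <= N by rewrite exprn_ge0.
have rhs0 : 0 <= 2 * ell%:R / N * sqnorm (compressed psi).
  by rewrite mulr_ge0 ?sqnorm_ge0 // divr_ge0 ?mulr_ge0 ?ler0n.
have [psi0|] := boolP [forall bH, psi bH == 0].
  have -> : sqnorm (compressed psi) = 0.
    apply/eqP/sqnorm0P/ffunP => bo; rewrite !ffunE big1 // => G _.
    by rewrite (eqP (forallP psi0 _)) mulr0.
  by rewrite mulr0 addr0 win_weight_ge0.
rewrite negb_forall => /existsP[[x H] nz].
have [pos [cons nzH]] := possible_restrict Hin nz.
have := needs_cut pos acc; case cb: (cut b) => [c|//] _.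
move: (acc); case ab: (accepted b) => [a|//] _.
have [size_le [e He [fe eC]]] := fresh_hit pos cb ab.
(* The retained list contains [e], so the loss [2 / N] is at most [2 * ell / N]. *)
have ell1 : (1 <= ell)%N by apply: leq_trans size_le; case: (retained a) He.
have goodb : good K Q b by rewrite /good cb (budgeted pos) (bounded pos cb).
rewrite /win_weight /= acc goodb /hit_weight /= cb.
pose y := ck_value e.
have yE : y = H (ck_point e) by apply: (proj2 (cons nzH)) ab He.
have off : forall b' (G : func), G (ck_point e) != y -> psi (b', G) = 0.
  move=> b' G ne; apply/eqP; apply: contraNT ne => nz'.
  have [_ [cons' nzG]] := possible_restrict Hin nz'.
  by rewrite /y (proj2 (cons' nzG) a e ab He).
have split_hit : sqnorm (compressed psi) = @wnorm R S OC (Hit Fresh c) (compressed psi)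
    + @wnorm R S OC (predC (Hit Fresh c)) (compressed psi).
  by rewrite sqnormE /wnorm (bigID (fun bo : basis S * database S => Hit Fresh c bo.2)).
rewrite {1}split_hit lerD2l.
apply: (@le_trans _ _ (2 / N * sqnorm (compressed psi))); last first.
  rewrite ler_wpM2r ?sqnorm_ge0 // ler_wpM2r ?invr_ge0 // -[leLHS]mulr1.
  by rewrite ler_wpM2l // ler1n.
apply: le_trans (off_check_le off); rewrite /wnorm big_mkcond [leRHS]big_mkcond /=.
apply: ler_sum => bo _; case: ifP => nhit; last by case: ifP => // _; apply: sqr_ge0.
rewrite ifT //; apply: contraNneq nhit => Dx.
by apply/existsP; exists (ck_point e); rewrite fe Dx yE.
Qed.

Lemma Pr_W_le : Pr_W E rule
  <= \sum_(r <- run OC E rule (@at_acceptance S)) win_weight Fresh K Q r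
     + 2 * ell%:R / N.
Proof.
have N0 : 0 <= N by rewrite exprn_ge0.
have C0 : 0 <= 2 * ell%:R / N by rewrite divr_ge0 ?mulr_ge0 ?ler0n.
rewrite Pr_WE big_mkcond.
apply: (@le_trans _ _ (\sum_(r <- run OC E rule (@at_acceptance S))
   (win_weight Fresh K Q r + 2 * ell%:R / N * sqnorm r.2))).
  rewrite run_compressedE !big_map; apply: sum_le_In => -[b psi] Hin /=.
  case: ifP => [acc|_]; first exact: accepted_branch_le.
  by apply: addr_ge0; [exact: win_weight_ge0|apply: mulr_ge0 => //; exact: sqnorm_ge0].
rewrite big_split /= -mulr_sumr lerD2l -[leRHS]mulr1.
by rewrite ler_wpM2l // run_norm_le.
Qed.

Lemma sqrtr_add_le (x y : R) : 0 <= x -> 0 <= y ->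
  Num.sqrt (x + y) <= Num.sqrt x + Num.sqrt y.
Proof.
move=> x0 y0; have s0 := @sqrtr_ge0 R.
rewrite -[leRHS]ger0_norm ?addr_ge0 // -sqrtr_sqr ler_sqrt ?sqr_ge0 //.
by rewrite sqrrD !sqr_sqrtr // lerD2r lerDl mulrn_wge0 ?mulr_ge0.
Qed.

Lemma sqrt_Pr_W_le : Num.sqrt (Pr_W E rule) <= beta_cut E rule Fresh
  + Q%:R * Num.sqrt (10%:R * K%:R / N) + Num.sqrt (2 * ell%:R / N).
Proof.
set W := \sum_(r <- run OC E rule (@at_acceptance S)) win_weight Fresh K Q r.
have W0 : 0 <= W by apply: sumr_ge0 => r _; apply: win_weight_ge0.
have N0 : 0 <= N by rewrite exprn_ge0.
have C0 : 0 <= 2 * ell%:R / N by rewrite divr_ge0 ?mulr_ge0 ?ler0n.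
apply: (@le_trans _ _ (Num.sqrt (W + 2 * ell%:R / N))).
  by rewrite ler_sqrt ?Pr_W_le // addr_ge0.
apply: le_trans (sqrtr_add_le W0 C0) _; rewrite lerD2r.
(* Initially no evaluation has been counted and the vector has norm 1, so the error is [Q]
   increments. *)
have := adv_growth rule Fresh K Q E (adv E) (branch0 E) (op_init OC (@amp0 _ _ E)).
by rewrite beta_cutE sqnorm_init sqrtr1 mulr1 /budget /= subn0.
Qed.

End MainBound.

(** Source of the factor 3 in the probability bound, and of 6 as 3 times 2. *)
Lemma sqr_sum3_le (R : realType) (x y z : R) :
  (x + y + z) ^+ 2 <= 3 * x ^+ 2 + 3 * y ^+ 2 + 3 * z ^+ 2.
Proof.
have := sqr_ge0 (x - y); have := sqr_ge0 (x - z); have := sqr_ge0 (y - z).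
by rewrite !expr2; lra.
Qed.

Theorem lemma1 (R : realType) :
  exists2 c_co : R, c_co = 10%:R &
  forall (S : signature) (E : execution R S) (rule : cut_rule S)
         (Fresh : freshness S) (K Q ell : nat),
    cut_bounded E rule K ->
    cut_closed E rule ->
    W_needs_cut E rule ->
    checks_follow_cut E rule ->
    W_has_fresh_hit E rule Fresh ell ->
    post_cut_budget E rule Q ->
    Num.sqrt (Pr_W E rule) <=
      beta_cut E rule Fresh
      + Q%:R * Num.sqrt (c_co * K%:R / 2 ^+ secpar S)
      + Num.sqrt (2 * ell%:R / 2 ^+ secpar S)
    /\
    Pr_W E rule <=
      3 * beta_cut E rule Fresh ^+ 2
      + 3 * c_co * K%:R * Q%:R ^+ 2 / 2 ^+ secpar S
      + 6 * ell%:R / 2 ^+ secpar S.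
Proof.
exists 10%:R => // S E rule Fresh K Q ell bounded _ needs_cut _ fresh_hit budgeted.
have le := sqrt_Pr_W_le bounded needs_cut fresh_hit budgeted; split=> //.
have W0 : 0 <= Pr_W E rule.
  by rewrite Pr_WE; apply: sumr_ge0 => r _; apply: sqnorm_ge0.
have N0 : (0 : R) <= 2 ^+ secpar S by rewrite exprn_ge0.
have K0 : (0 : R) <= 10%:R * K%:R / 2 ^+ secpar S.
  by rewrite divr_ge0 ?mulr_ge0 ?ler0n.
have l0 : (0 : R) <= 2 * ell%:R / 2 ^+ secpar S.
  by rewrite divr_ge0 ?mulr_ge0 ?ler0n.
rewrite -[Pr_W E rule]sqr_sqrtr //.
have := le; rewrite -(ler_pXn2r (isT : (0 < 2)%N)) ?nnegrE ?sqrtr_ge0 //; last first.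
  by rewrite !addr_ge0 ?mulr_ge0 ?sqrtr_ge0 ?ler0n.
move=> /le_trans; apply; apply: le_trans (sqr_sum3_le _ _ _) _.
rewrite exprMn (sqr_sqrtr K0) (sqr_sqrtr l0) le_eqVlt; apply/orP; left; apply/eqP.
ring.
Qed.
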